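(* Suppose there is an optimal primal-dual pair $(z_*,p_* )$, i.e. $0\in\nabla\psi_s(z_* )+\partial\psi_n(z_* )+\mathcal A^*p_*$ and $\mathcal Az_*-b=0$, with $p_*$ attaining the optimal dual value. Then: (a) The O-IAL method requires at most $$\mathcal O\left(\frac{\Pi(p_0)}{\hat\epsilon^2c^2}\sqrt{\left(\bar L+c\|\mathcal A\|^2\right)\max\left\{\frac{D^2}{c\hat\epsilon^2},\frac{D}{\hat\rho}\right\}}\right)$$ resolvent/gradient evaluations to find an $(\hat\epsilon,\hat\rho)$-approximate solution, i.e. a triple $(z,p,r)$ satisfying $$r\in\nabla\psi_s(z)+\partial\psi_n(z)+\mathcal A^*p,\quad\|r\|\le\hat\rho,\quad\|\mathcal Az-b\|\le\hat\epsilon.$$ (b) By choosing the penalty parameter $c$ as $c=\mathcal O(1/\hat\epsilon)$, the complexity bound in (a) is reduced to the optimal gradient evaluation complexity bound $$\mathcal O\left(\Pi(p_0)\sqrt{\left(\bar L+\frac{\|\mathcal A\|^2}{\hat\epsilon}\right)\max\left\{\frac{D^2}{\hat\epsilon},\frac{D}{\hat\rho}\right\}}\right).$$ Hence, if $\hat\epsilon=\hat\rho$, the O-IAL method requires at most $\mathcal O(1/\hat\epsilon)$ total gradient evaluations to find an $(\hat\epsilon,\hat\epsilon)$-approximate solution.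
   Context: Problem: $\min\{\psi(z):=\psi_s(z)+\psi_n(z):\mathcal Az=b\}$, where $\mathbb E$ is a finite-dimensional Euclidean space, $\mathcal A:\mathbb E\to\mathbb R^m$ is a nonzero linear map with adjoint $\mathcal A^*$, $b\in\mathbb R^m$; $\psi_s:\mathbb E\to\mathbb R$ is convex and differentiable with $\bar L$-Lipschitz gradient; $\psi_n$ is closed proper convex with compact convex domain $\operatorname{dom}\psi_n$ of diameter $D$. $\mathcal L_c^s(z,p)=\psi_s(z)+\langle p,\mathcal Az-b\rangle+\frac c2\|\mathcal Az-b\|^2$. $\mathcal P_\star$ is the set of optimal dual solutions, i.e. maximizers of the dual function $p\mapsto\min_z\{\psi(z)+\langle p,\mathcal Az-b\rangle\}$, and $\Pi(p)=\operatorname{dist}^2(p,\mathcal P_\star)$. O-IAL (inputs $z_0\in\operatorname{dom}\psi_n$, $p_0\in\mathbb R^m$, $(\hat\epsilon,\hat\rho)\in\mathbb R_{++}^2$, $c>0$): set $\epsilon=\min\{c\hat\epsilon^2/(4D),\hat\rho\}$. Choose $w_0\in\operatorname{dom}\psi_n$ with $w_0\ne z_0$ and $\nabla\psi_s(w_0)\neq\nabla\psi_s(z_0)$, and set $M_0=\|\nabla\psi_s(z_0)-\nabla\psi_s(w_0)\|/(4\|z_0-w_0\|)$, $D_0=\|z_0-w_0\|$ (if $\psi_s$ is affine, $M_0>0$ is arbitrary and $\bar L$ is taken large enough that $M_0\le2\bar L$). For $k=1,2,\dots$: run PF-AR with pair $(\mathcal L_c^s(\cdot,p_{k-1}),\psi_n)$,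 initial point $z_{k-1}$, estimates $M_0,D_0$, tolerance $\epsilon$, and call its output $(z_k,r_k)$; set $p_k=p_{k-1}+c(\mathcal Az_k-b)$; stop as soon as $\|\mathcal Az_k-b\|\le\hat\epsilon$ and output $(z_k,p_k,r_k)$. The subroutine PF-AR is described for a generic pair $(f,h)$, $f$ convex with $L_f$-Lipschitz gradient, $h$ closed proper convex with compact domain. Backtracking$(f,h,\sigma,x,\bar x,M_0)$: for $j=0,1,\dots$ compute $x^{++}=\arg\min_u\langle\nabla f(x),u\rangle+h(u)+\frac{\sigma}{2}\|u-\bar x\|^2+M_j\|u-x\|^2$ and $x^{+}=\arg\min_u\langle\nabla f(x),u\rangle+h(u)+M_j\|u-x\|^2$. If $f(x^{++})-f(x)-\langle\nabla f(x),x^{++}-x\rangle\le\frac{M_j}{2}\|x^{++}-x\|^2$ and $\|\nabla f(x^+)-\nabla f(x)\|\le M_j\|x^+-x\|$, return $(x^{++},x^+,M_j)$; otherwise set $M_{j+1}=2M_j$. Inner solver $\mathsf A$ (assumed available): the call $x_s=\mathsf A(f,h,\sigma_s,\bar x_s,x_{s-1})$, started at $x_{s-1}$, approximately minimizes $\phi_s(u)=f(u)+h(u)+\frac{\sigma_s}{2}\|u-\bar x_s\|^2$, whose minimizer is $x_s^*$. After its $k$-th evaluation of $\nabla f$ it has a point $x_s^k\in\operatorname{dom}h$ and an estimate $L_s^k\le c_{\mathsf A}L_f$ ($c_{\mathsf A}$ a universal constant depending on $\mathsf A$) with $\phi_s(x_s^k)-\phi_s(x_s^* )\le\frac{L_s^k}{k^2}\|x_{s-1}-x_s^*\|^2$.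 It terminates whenever $k\ge8\sqrt{2L_s^k/\sigma_s}$ and outputs $x_s=x_s^k$. AR-L$(f,h,x_0,\sigma_1,M_0)$: for $s=1,2,\dots$: if $s=1$ set $\bar x_1=x_0$; if $s\ge2$ set $\sigma_s=4\sigma_{s-1}$, $\gamma_s=1-\sigma_{s-1}/\sigma_s$, $\bar x_s=(1-\gamma_s)\bar x_{s-1}+\gamma_sx_{s-1}$. Compute $x_s=\mathsf A(f,h,\sigma_s,\bar x_s,x_{s-1})$, $(x_s^{++},x_s^+,M_s)=$ Backtracking$(f,h,\sigma_s,x_s,\bar x_s,M_{s-1})$, $v_s=2M_s(x_s-x_s^+)-\nabla f(x_s)+\nabla f(x_s^+)$. Stop as soon as $M_s\le\sigma_s$ and output $(x_s^+,v_s,M_s)$. PF-AR (inputs $(f,h)$, $x_0$, $M_0$, $D_0$, $\epsilon$): for $t=1,2,\dots$ set $D_t=4D_{t-1}$, run AR-L$(f,h,x_{t-1},\epsilon/(7D_t),M_{t-1})$ with output $(x_t,v_t,M_t)$; stop as soon as $\|v_t\|\le\epsilon$ and output $(x_t,v_t)$.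
   Formalization: The O-bounds carry constants depending on κ>0 where Π(p_0)/(ε̂²c²)≥κ (in (b): Π(p_0)≥κ) and κε≤M_0D_0; for all inputs a bound with extra 1+ and log terms is given. c=O(1/ε̂) is read as Θ(1/ε̂), and A uses at most q resolvents per gradient. *)

(* Defs.v *)
From HB Require Import structures.
From mathcomp Require Import all_boot all_order all_algebra.
From mathcomp Require Import all_classical all_reals all_analysis.

Set Implicit Arguments.
Unset Strict Implicit.
Unset Printing Implicit Defensive.

Import Order.TTheory GRing.Theory Num.Theory.
Import numFieldNormedType.Exports.

Local Open Scope classical_set_scope.
Local Open Scope ring_scope.

Section EuclideanRm.
Context {R : realType} {m : nat}.
Implicit Types p q : 'rV[R]_m.

(* The library norm `|p| on 'rV[R]_m is the max norm, hence this one. *)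
Definition dotv p q : R := \sum_i p 0 i * q 0 i.
Definition enorm p : R := Num.sqrt (dotv p p).

Definition edist p (S : set 'rV[R]_m) : R := inf [set enorm (p - q) | q in S].

End EuclideanRm.

Section Euclidean.
Context {R : realType} {E : normedModType R}.

(* A finite-dimensional Euclidean space is a finitely generated normed space
   whose norm is induced by an inner product. *)
Definition inner_product_norm (ip : {dot E for idfun}) :=
  forall x, ip x x = `|x| ^+ 2.

Definition finite_dimensional :=
  exists (n : nat) (e : 'I_n -> E),
    forall x, exists a : 'I_n -> R, x = \sum_i a i *: e i.

Definition diameter (S : set E) : R := sup [set `|x - y| | x in S & y in S].

Definition opnorm (m : nat) (A : {linear E -> 'rV[R]_m}) : R :=
  sup [set enorm (A z) | z in [set z | `|z| <= 1]].

Definition edom (h : E -> \bar R) : set E := [set x | (h x < +oo)%E].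

Definition proper (h : E -> \bar R) :=
  (forall x, (-oo < h x)%E) /\ edom h !=set0.

(* For proper h the right-hand side never involves oo - oo. *)
Definition econvex (h : E -> \bar R) := forall (x y : E) (t : R), 0 <= t <= 1 ->
  (h (t *: x + (1 - t) *: y)%R <= t%:E * h x + (1 - t)%R%:E * h y)%E.

Definition closed_proper_convex (h : E -> \bar R) :=
  [/\ lower_semicontinuous h, proper h & econvex h].

Definition is_argmin (F : E -> \bar R) (x : E) := forall u, (F x <= F u)%E.

Definition affine_function (f : E -> R) :=
  exists (a : {linear E -> R}) (beta : R), forall x, f x = a x + beta.

End Euclidean.

Section Gradient.
Context {R : realType} {E : normedModType R} (ip : {dot E for idfun}).

Definition grad (f : E -> R) (x : E) : E :=
  xget 0 [set g | forall v, 'd f x v = ip g v].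

Definition convex_smooth (f : E -> R) (L : R) :=
  [/\ convex_function [set: E] f,
      forall x, differentiable f x &
      forall x y, `|grad f x - grad f y| <= L * `|x - y| ].

Definition subdiff (h : E -> \bar R) (x : E) : set E :=
  [set g | edom h x /\ forall u, (h x + (ip g (u - x))%:E <= h u)%E].

End Gradient.

Section InnerSolver.
Context {R : realType} {E : normedModType R}.

Definition reg_obj (f : E -> R) (h : E -> \bar R) (sigma : R) (xbar : E)
    (u : E) : \bar R :=
  ((f u + sigma / 2 * `|u - xbar| ^+ 2)%:E + h u)%E.

(* An inner solver started on (f, h, sigma, xbar, x0) is described by what it
   holds after its k-th evaluation of the gradient of f, k >= 1: an iterate, an
   estimate of the Lipschitz constant, and the number of resolvents of h
   computed so far. *)
Record inner_solver := InnerSolver {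
  sol_iter : (E -> R) -> (E -> \bar R) -> R -> E -> E -> nat -> E ;
  sol_est : (E -> R) -> (E -> \bar R) -> R -> E -> E -> nat -> R ;
  sol_res : (E -> R) -> (E -> \bar R) -> R -> E -> E -> nat -> nat }.

Definition inner_solver_spec (ip : {dot E for idfun}) (S : inner_solver)
    (cA : R) (q : nat) :=
  forall f h Lf sigma xbar x0,
    0 < Lf -> convex_smooth ip f Lf ->
    closed_proper_convex h -> compact (edom h) ->
    0 < sigma -> edom h x0 ->
    forall k, (0 < k)%N ->
      let x := sol_iter S f h sigma xbar x0 k in
      let L := sol_est S f h sigma xbar x0 k in
      [/\ edom h x, 0 <= L <= cA * Lf,
          (sol_res S f h sigma xbar x0 k <= q * k)%N &
          forall xs, is_argmin (reg_obj f h sigma xbar) xs ->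
            (reg_obj f h sigma xbar x <= reg_obj f h sigma xbar xs
               + (L / k%:R ^+ 2 * `|x0 - xs| ^+ 2)%:E)%E].

(* The call returns xs, at the first k >= 1 that meets the termination test,
   after n gradient and resolvent evaluations. *)
Definition solver_call (S : inner_solver) f h sigma xbar x0 (xs : E)
    (n : nat) :=
  let test k := 8 * Num.sqrt (2 * sol_est S f h sigma xbar x0 k / sigma)
                  <= k%:R in
  exists k, [/\ (0 < k)%N, test k,
    forall j, (0 < j < k)%N -> ~~ test j,
    xs = sol_iter S f h sigma xbar x0 k &
    n = (k + sol_res S f h sigma xbar x0 k)%N].

End InnerSolver.

(* In the relations below, the last argument counts the evaluations of the
   gradient of f plus the evaluations of resolvents of h. A relation holds only
   of executions that stop. *)
Section Algorithms.
Context {R : realType} {E : normedModType R} (ip : {dot E for idfun}).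
Variable S : inner_solver (R := R) (E := E).
Variables (f : E -> R) (h : E -> \bar R).
Let df := grad ip f.

Definition bt_trial (sigma : R) (x xbar : E) (M : R) (xpp xp : E) :=
  is_argmin (fun u => (ip (df x) u + sigma / 2 * `|u - xbar| ^+ 2
                         + M * `|u - x| ^+ 2)%:E + h u)%E xpp /\
  is_argmin (fun u => (ip (df x) u + M * `|u - x| ^+ 2)%:E + h u)%E xp.

Definition bt_accept (x : E) (M : R) (xpp xp : E) :=
  f xpp - f x - ip (df x) (xpp - x) <= M / 2 * `|xpp - x| ^+ 2 /\
  `|df xp - df x| <= M * `|xp - x|.

(* A trial costs two resolvents and the gradient at xp. *)
Inductive bt_loop (sigma : R) (x xbar : E) : R -> E * E * R -> nat -> Prop :=
| bt_stop M xpp xp :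
    bt_trial sigma x xbar M xpp xp -> bt_accept x M xpp xp ->
    bt_loop sigma x xbar M (xpp, xp, M) 3
| bt_next M xpp xp out n :
    bt_trial sigma x xbar M xpp xp -> ~ bt_accept x M xpp xp ->
    bt_loop sigma x xbar (2 * M) out n ->
    bt_loop sigma x xbar M out (3 + n).

(* One more evaluation, for the gradient at x. *)
Definition backtracking sigma x xbar M0 out (n : nat) :=
  exists2 n', bt_loop sigma x xbar M0 out n' & n = n'.+1.

Definition arl_residual (x xp : E) (M : R) : E :=
  (2 * M) *: (x - xp) - df x + df xp.

(* The arguments are sigma_s, xbar_s, x_(s-1), M_(s-1), then the output. *)
Inductive arl_loop :
    R -> E -> E -> R -> E * E * R -> nat -> Prop :=
| arl_stop sigma xbar x M xs xpp xp Ms n1 n2 :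
    solver_call S f h sigma xbar x xs n1 ->
    backtracking sigma xs xbar M (xpp, xp, Ms) n2 ->
    Ms <= sigma ->
    arl_loop sigma xbar x M (xp, arl_residual xs xp Ms, Ms) (n1 + n2)
| arl_next sigma xbar x M xs xpp xp Ms n1 n2 out n :
    solver_call S f h sigma xbar x xs n1 ->
    backtracking sigma xs xbar M (xpp, xp, Ms) n2 ->
    ~~ (Ms <= sigma) ->
    let sigma' := 4 * sigma in
    let gamma := 1 - sigma / sigma' in
    arl_loop sigma' ((1 - gamma) *: xbar + gamma *: xs) xs Ms out n ->
    arl_loop sigma xbar x M out (n1 + n2 + n).

Definition AR_L (x0 : E) (sigma1 M0 : R) out n :=
  arl_loop sigma1 x0 x0 M0 out n.

(* The arguments are x_(t-1), M_(t-1), D_(t-1), then the output. *)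
Inductive PF_AR (eps : R) : E -> R -> R -> E * E -> nat -> Prop :=
| pfar_stop x M D x' v' M' n :
    AR_L x (eps / (7 * (4 * D))) M (x', v', M') n ->
    `|v'| <= eps ->
    PF_AR eps x M D (x', v') n
| pfar_next x M D x' v' M' n out n' :
    AR_L x (eps / (7 * (4 * D))) M (x', v', M') n ->
    ~~ (`|v'| <= eps) ->
    PF_AR eps x' M' (4 * D) out n' ->
    PF_AR eps x M D out (n + n').

End Algorithms.

Section OIAL.
Context {R : realType} {E : normedModType R} (ip : {dot E for idfun}).
Variable m : nat.
Variables (psis : E -> R) (psin : E -> \bar R).
Variables (A : {linear E -> 'rV[R]_m}) (Astar : 'rV[R]_m -> E) (b : 'rV[R]_m).

Definition adjoint := forall z p, ip z (Astar p) = dotv (A z) p.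

Definition aug_lagrangian (c : R) (p : 'rV[R]_m) (z : E) : R :=
  psis z + dotv p (A z - b) + c / 2 * enorm (A z - b) ^+ 2.

Definition dual_function (p : 'rV[R]_m) : \bar R :=
  ereal_inf (range (fun z => ((psis z + dotv p (A z - b))%:E + psin z)%E)).

Definition dual_solutions : set 'rV[R]_m :=
  [set p | forall p', (dual_function p' <= dual_function p)%E].

Definition dual_dist2 (p : 'rV[R]_m) : R := edist p dual_solutions ^+ 2.

Definition optimal_pair (z : E) (p : 'rV[R]_m) :=
  [/\ subdiff ip psin z (0 - grad ip psis z - Astar p),
      A z - b = 0 & dual_solutions p].

Definition approx_solution (eh rh : R) (o : E * 'rV[R]_m * E) :=
  let: (z, p, r) := o in
  [/\ subdiff ip psin z (r - grad ip psis z - Astar p),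
      `|r| <= rh & enorm (A z - b) <= eh].

Definition initial_estimates (Lbar : R) (z0 w0 : E) (M0 D0 : R) :=
  [/\ edom psin z0, edom psin w0, w0 != z0, D0 = `|z0 - w0| &
      (grad ip psis w0 != grad ip psis z0 /\
         M0 = `|grad ip psis z0 - grad ip psis w0| / (4 * `|z0 - w0|)) \/
      (affine_function psis /\ 0 < M0 <= 2 * Lbar)].

Definition oial_eps (c eh rh : R) : R :=
  Num.min (c * eh ^+ 2 / (4 * diameter (edom psin))) rh.

Variables (S : inner_solver (R := R) (E := E)).

(* The state arguments are z_(k-1) and p_(k-1). *)
Inductive oial_loop (c eh rh M0 D0 : R) :
    E -> 'rV[R]_m -> E * 'rV[R]_m * E -> nat -> Prop :=
| oial_stop z p z' r' n :
    PF_AR ip S (aug_lagrangian c p) psin (oial_eps c eh rh) z M0 D0 (z', r') n ->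
    enorm (A z' - b) <= eh ->
    oial_loop c eh rh M0 D0 z p (z', p + c *: (A z' - b), r') n
| oial_next z p z' r' n out n' :
    PF_AR ip S (aug_lagrangian c p) psin (oial_eps c eh rh) z M0 D0 (z', r') n ->
    ~~ (enorm (A z' - b) <= eh) ->
    oial_loop c eh rh M0 D0 z' (p + c *: (A z' - b)) out n' ->
    oial_loop c eh rh M0 D0 z p out (n + n').

(* Two more evaluations, for the gradients that define M0. *)
Definition O_IAL (c eh rh M0 D0 : R) z0 p0 out (n : nat) :=
  exists2 n', oial_loop c eh rh M0 D0 z0 p0 out n' & n = n'.+2.

End OIAL.

(* Main.v *)
Require Import Defs.
From HB Require Import structures.
From mathcomp Require Import all_boot all_order all_algebra.
From mathcomp Require Import all_classical all_reals all_analysis.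
From mathcomp Require Import ring lra finmap.

Set Implicit Arguments.
Unset Strict Implicit.
Unset Printing Implicit Defensive.

Import Order.TTheory GRing.Theory Num.Theory.
Import numFieldNormedType.Exports.

Local Open Scope classical_set_scope.
Local Open Scope ring_scope.

(** O-IAL is an inexact proximal point method on the dual. Write c for the
    penalty, D for the diameter of dom psi_n, L = Lbar + c |A|^2 for the modulus
    of the gradient of the augmented Lagrangian, and eps for the inner tolerance.

    Outer loop. An inner call at p_(k-1) returns z_k and a residual r_k with
    |r_k| <= eps, and r_k is a subgradient at z_k of the Lagrangian for the
    updated multiplier p_k = p_(k-1) + c (A z_k - b), because the gradient of
    the augmented Lagrangian for p_(k-1) is the one of the plain Lagrangian for
    p_k. So z_k minimizes that Lagrangian up to eps D <= c eh^2 / 4, and for a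
    dual solution ps this reads <p_k - ps, A z_k - b> <= c eh^2 / 4. Expanding
    the square, |p_k - ps|^2 is at most
    |p_(k-1) - ps|^2 + c^2 eh^2 / 2 - c^2 |A z_k - b|^2, so as long as the
    stopping test fails the squared distance to each dual solution decreases by
    at least c^2 eh^2 / 2 ([multiplier_progress]). Hence at most
    1 + 2 Pi0 / (c eh)^2 inner calls.

    AR-L. Stage s regularizes with sigma_s = 4^(s-1) sigma_1, and its exact
    minimizer y_s is moved little by the next stage: adding
    (3 sigma_s / 2) |u - x_s|^2 can only bring the minimizer closer to x_s
    ([prox_center_shift]), while the inner solver divides the distance to the
    minimizer by 8. Since 4 / 8 < 1, the quantity
    sigma_s |y_s - xbar_s| + sigma_s |x_(s-1) - y_s| never exceeds its
    initial value 2 sigma_1 D ([arl_loop_spec]). At the last stage, where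
    M_s <= sigma_s, it bounds the residual by 3 sigma_1 D
    ([arl_residual_norm]). Backtracking keeps M_s <= 4 L, which ends the stages,
    and the costs sqrt (L / sigma_s) form a geometric series.

    PF-AR. With sigma_1 = eps / (7 D_t) the residual is at most eps as soon as
    D_t >= D; the costs sqrt (L D_t / eps) again form a geometric series, so a
    call costs O (sqrt (L D / eps)) plus logarithms of D / D0 and L / M0 that
    count the guesses of D and the doublings of M ([pfar_bound]).

    When the initial gradient difference M0 D0 is not small against eps, the
    logarithms are dominated by the square root ([lower_order_terms]); the other
    bounds follow by substituting c ~ 1 / eh. *)

(** * Inner products and gradients *)

(** The nonnegative quadratic in t is evaluated at its minimizer b / c or, when
    it is affine, at a point where it equals -1 unless b = 0. *)
Lemma discriminant_le (R : realFieldType) (a b c : R) : 0 <= c ->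
  (forall t, 0 <= a - 2 * t * b + t ^+ 2 * c) -> b ^+ 2 <= a * c.
Proof.
move=> c0 H; have [c_eq0|c_neq0] := eqVneq c 0; last first.
  have := H (b / c).
  have -> : a - 2 * (b / c) * b + (b / c) ^+ 2 * c = (a * c - b ^+ 2) / c by field.
  by rewrite pmulr_lge0 ?invr_gt0 ?lt_def ?c_neq0 // subr_ge0.
have [->|b_neq0] := eqVneq b 0; first by rewrite c_eq0; lra.
have := H ((a + 1) / (2 * b)); rewrite c_eq0.
have -> : a - 2 * ((a + 1) / (2 * b)) * b + ((a + 1) / (2 * b)) ^+ 2 * 0 = -1.
  by field.
by lra.
Qed.

Section InnerProduct.
Context {R : realType} {E : normedModType R} (ip : {dot E for idfun}).
Hypothesis ip_norm : inner_product_norm ip.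
Implicit Types x y z : E.

Lemma ipC x y : ip x y = ip y x.
Proof. by have := hermC ip x y; rewrite /= expr0 mul1r. Qed.

Lemma ipDr x y z : ip x (y + z) = ip x y + ip x z.
Proof. exact: linearDr. Qed.

Lemma ipDl x y z : ip (x + y) z = ip x z + ip y z.
Proof. exact: linearDl. Qed.

Lemma ipNr x y : ip x (- y) = - ip x y.
Proof. exact: linearNr. Qed.

Lemma ipNl x y : ip (- x) y = - ip x y.
Proof. exact: linearNl. Qed.

Lemma ipZr (a : R) x y : ip x (a *: y) = a * ip x y.
Proof. exact: (linearZr_LR ip). Qed.

Lemma ipZl (a : R) x y : ip (a *: x) y = a * ip x y.
Proof. by rewrite ipC ipZr ipC. Qed.

Lemma ip0l x : ip 0 x = 0.
Proof. exact: linear0l. Qed.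

Lemma ip_suml I (r : seq I) (F : I -> E) x :
  ip (\sum_(i <- r) F i) x = \sum_(i <- r) ip (F i) x.
Proof. by elim/big_rec2: _ => [|i y z _ <-]; rewrite ?ip0l ?ipDl. Qed.

Lemma ip_sumr I (r : seq I) (F : I -> E) x :
  ip x (\sum_(i <- r) F i) = \sum_(i <- r) ip x (F i).
Proof. by rewrite ipC ip_suml; apply: eq_bigr => i _; rewrite ipC. Qed.

Definition ipE := (ipDl, ipDr, ipNl, ipNr, ipZl, ipZr).

Lemma sqnormD x y : `|x + y| ^+ 2 = `|x| ^+ 2 + 2 * ip x y + `|y| ^+ 2.
Proof. by rewrite -!ip_norm !ipE (ipC y x); ring. Qed.

Lemma sqnormB x y : `|x - y| ^+ 2 = `|x| ^+ 2 - 2 * ip x y + `|y| ^+ 2.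
Proof. by rewrite sqnormD normrN ipNr; ring. Qed.

Lemma Cauchy_Schwarz x y : ip x y <= `|x| * `|y|.
Proof.
apply: (le_trans (ler_norm _)); rewrite -(@ler_pXn2r _ 2) ?nnegrE ?mulr_ge0 //.
rewrite real_normK ?num_real // exprMn; apply: discriminant_le => [|t].
  by rewrite sqr_ge0.
have -> : `|x| ^+ 2 - 2 * t * ip x y + t ^+ 2 * `|y| ^+ 2 = `|x - t *: y| ^+ 2.
  by rewrite sqnormB ipZr normrZ exprMn real_normK ?num_real //; ring.
exact: sqr_ge0.
Qed.

Lemma ip_norm_le x y : `|ip x y| <= `|x| * `|y|.
Proof.
by rewrite ler_norml Cauchy_Schwarz andbT lerNl -ipNl -(normrN x) Cauchy_Schwarz.
Qed.

Lemma continuous_ip x : continuous (ip x : E -> R).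
Proof.
apply: (@bounded_linear_continuous R E R (ip x)).
apply/linear_boundedP; near=> r => y.
apply: (le_trans (ip_norm_le x y)); apply: ler_wpM2r; first exact: normr_ge0.
by near: r; apply: nbhs_pinfty_ge; rewrite num_real.
Unshelve. all: by end_near. Qed.

(** The coefficients of g solve a linear system with the Gram matrix G of the
    generators, which may be singular. It is solvable because a vector in the
    kernel of G is a combination of the generators with norm zero, so that the
    functional vanishes on it. *)
Lemma Riesz (a : {linear E -> R}) : @finite_dimensional R E ->
  exists g, forall v, a v = ip g v.
Proof.
move=> [n [e e_span]].
pose G : 'M[R]_n := \matrix_(i, j) ip (e i) (e j).
pose r : 'rV[R]_n := \row_j a (e j).
have : (r <= G)%MS.
  rewrite submxE; apply/eqP/rowP => j; rewrite !mxE.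
  pose y := \sum_i cokermx G i j *: e i.
  have y0 : y = 0.
    apply/eqP; rewrite -normr_eq0 -sqrf_eq0 -ip_norm {2}/y ip_sumr.
    rewrite big1 // => i _; rewrite ipZr /y ip_suml.
    have := congr1 (fun M : 'M[R]_n => M i j) (mulmx_coker G).
    rewrite !mxE => GC; rewrite [X in _ * X](_ : _ = 0) ?mulr0 // -[RHS]GC.
    by apply: eq_bigr => k _; rewrite [G _ _]mxE ipZl mulrC ipC.
  transitivity (a y); last by rewrite y0 linear0.
  by rewrite linear_sum; apply: eq_bigr => k _; rewrite [r _ _]mxE linearZ /= mulrC.
case/submxP => c rcG; exists (\sum_i c 0 i *: e i) => v.
have [b ->] := e_span v; rewrite linear_sum ip_sumr; apply: eq_bigr => j _.
rewrite linearZ /= ipZr; congr (_ * _).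
have := congr1 (fun M : 'rV[R]_n => M 0 j) rcG; rewrite !mxE => ->.
by rewrite ip_suml; apply: eq_bigr => i _; rewrite [G _ _]mxE ipZl.
Qed.

Lemma grad_eq f x g : (forall v, 'd f x v = ip g v) -> grad ip f x = g.
Proof.
move=> dfg; rewrite /grad; case: xgetP => [g' _ dfg'|/(_ g)]; last by [].
apply/eqP; rewrite -subr_eq0 -normr_eq0 -sqrf_eq0 -ip_norm.
by rewrite ipDl ipNl -dfg -dfg' subrr.
Qed.

Lemma gradE f x v : @finite_dimensional R E -> 'd f x v = ip (grad ip f x) v.
Proof.
move=> E_fin; have [g dfg] := Riesz ('d f x) E_fin.
by rewrite (grad_eq dfg) dfg.
Qed.

(** Differentiability from a quadratic remainder: the form in which the penalty
    term, whose expansion is exact, comes. *)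
Lemma quadratic_is_diff (f : E -> R) x g (C : R) :
  (forall v, `|f (x + v) - f x - ip g v| <= C * `|v| ^+ 2) ->
  is_diff x f (ip g).
Proof.
move=> fC.
have xpn : f \o shift x = cst (f x) + (ip g : E -> R) +o_ 0 id.
  apply/eqaddoP => e e0; near=> v.
  have -> : (f \o shift x - (cst (f x) + (ip g : E -> R))) v
     = f (x + v) - f x - ip g v.
    by rewrite !fctE /= (addrC v) opprD addrA.
  apply: (le_trans (fC v)); rewrite expr2 mulrA ler_wpM2r //.
  apply: (@le_trans _ _ ((`|C| + 1) * `|v|)).
    rewrite ler_wpM2r //; apply: (le_trans (ler_norm _)); lra.
  rewrite -ler_pdivlMl; last by rewrite ltr_wpDl.
  near: v; apply: nbhs0_le; rewrite mulr_gt0 // invr_gt0 ltr_wpDl //.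
have dE := @diff_unique _ _ _ _ (ip g) x (continuous_ip (x := g)) xpn.
apply: DiffDef; last exact: dE.
apply/diff_locallyP; rewrite dE; split; [exact: continuous_ip|exact: xpn].
Unshelve. all: by end_near. Qed.

End InnerProduct.

(** * Convex functions with Lipschitz gradient *)

Section ConvexGradient.
Context {R : realType} {E : normedModType R} (ip : {dot E for idfun}).
Hypothesis ip_norm : inner_product_norm ip.
Hypothesis E_fin : @finite_dimensional R E.
Implicit Types (f : E -> R) (x y z : E).

Lemma convex_functionP f : convex_function [set: E] f <->
  forall x y t, 0 <= t <= 1 ->
    f (t *: x + (1 - t) *: y) <= t * f x + (1 - t) * f y.
Proof.
split=> [f_cvx x y t /andP[t0 t1]|f_cvx t x y _ _].
  by have := f_cvx (Itv01 t0 t1) x y (mem_set I) (mem_set I).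
have t01 : 0 <= t%:num <= 1 by rewrite ge0 le1.
exact: (f_cvx x y t%:num t01).
Qed.

(** By convexity the difference quotients along the segment from x to y are at
    most f y - f x, and they tend to the directional derivative. *)
Lemma gradient_inequality f x y :
  convex_function [set: E] f -> differentiable f x ->
  f x + ip (grad ip f x) (y - x) <= f y.
Proof.
move=> /convex_functionP f_cvx f_diff.
rewrite -(gradE ip_norm) // -deriveE // -lerBrDl.
have := @diff_derivable _ _ _ f x (y - x) f_diff.
rewrite /derivable -/(derive f x (y - x)) => /cvg_dnbhs_at_right dl.
apply: (cvgr_to_le dl); near=> t.
have t0 : 0 < t by near: t; exact: nbhs_right_gt.
have t1 : t <= 1 by near: t; apply: nbhs_right_le.
rewrite /GRing.scale /= ler_pdivrMl //.
have := f_cvx y x t; rewrite (ltW t0) t1 => /(_ isT).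
have -> : t *: y + (1 - t) *: x = t *: (y - x) + x.
  by rewrite scalerBl scale1r scalerBr addrA addrAC.
lra.
Unshelve. all: by end_near. Qed.

(** Adding the gradient inequality at y to the Lipschitz bound avoids the
    integration that would give the sharp constant L / 2; the only effect is
    that backtracking is sure to accept at 2 L rather than at L. *)
Lemma convex_smooth_upper f L x y : convex_smooth ip f L ->
  f y <= f x + ip (grad ip f x) (y - x) + L * `|y - x| ^+ 2.
Proof.
move=> [f_cvx f_diff f_lip].
have := gradient_inequality x f_cvx (f_diff y).
have := Cauchy_Schwarz ip_norm (grad ip f y - grad ip f x) (y - x).
have : `|grad ip f y - grad ip f x| * `|y - x| <= L * `|y - x| ^+ 2.
  by rewrite expr2 mulrA ler_wpM2r.
by rewrite -(opprB y x) !ipE; lra.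
Qed.

End ConvexGradient.

(** * The augmented Lagrangian *)

Section DotV.
Context {R : realType} {m : nat}.
Implicit Types p q r : 'rV[R]_m.

Lemma dotvC p q : dotv p q = dotv q p.
Proof. by apply: eq_bigr => i _; rewrite mulrC. Qed.

Lemma dotvDl p q r : dotv (p + q) r = dotv p r + dotv q r.
Proof. by rewrite -big_split; apply: eq_bigr => i _; rewrite mxE mulrDl. Qed.

Lemma dotvZl (a : R) p q : dotv (a *: p) q = a * dotv p q.
Proof. by rewrite big_distrr; apply: eq_bigr => i _; rewrite /= mxE mulrA. Qed.

Lemma dotvDr p q r : dotv r (p + q) = dotv r p + dotv r q.
Proof. by rewrite dotvC dotvDl !(dotvC r). Qed.

Lemma dotvZr (a : R) p q : dotv p (a *: q) = a * dotv p q.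
Proof. by rewrite dotvC dotvZl dotvC. Qed.

Lemma dotvNl p q : dotv (- p) q = - dotv p q.
Proof. by rewrite -scaleN1r dotvZl mulN1r. Qed.

Lemma dotvNr p q : dotv p (- q) = - dotv p q.
Proof. by rewrite dotvC dotvNl dotvC. Qed.

Definition dotvE := (dotvDl, dotvDr, dotvZl, dotvZr, dotvNl, dotvNr).

Lemma dotv_ge0 p : 0 <= dotv p p.
Proof. by apply: sumr_ge0 => i _; rewrite -expr2 sqr_ge0. Qed.

Lemma sqr_enorm p : enorm p ^+ 2 = dotv p p.
Proof. by rewrite sqr_sqrtr // dotv_ge0. Qed.

Lemma enorm_ge0 p : 0 <= enorm p.
Proof. exact: sqrtr_ge0. Qed.

Lemma dotv_Cauchy_Schwarz p q : dotv p q <= enorm p * enorm q.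
Proof.
apply: (le_trans (ler_norm _)).
rewrite -(@ler_pXn2r _ 2) ?nnegrE ?mulr_ge0 ?enorm_ge0 //.
rewrite real_normK ?num_real // exprMn; apply: discriminant_le => [|t].
  by rewrite sqr_ge0.
have -> : enorm p ^+ 2 - 2 * t * dotv p q + t ^+ 2 * enorm q ^+ 2
          = enorm (p - t *: q) ^+ 2.
  by rewrite !sqr_enorm !dotvE (dotvC q p); ring.
exact: sqr_ge0.
Qed.

End DotV.

Section Adjoint.
Context {R : realType} {E : normedModType R} (ip : {dot E for idfun}).
Hypothesis ip_norm : inner_product_norm ip.
Context {m : nat} (A : {linear E -> 'rV[R]_m}) (Astar : 'rV[R]_m -> E).
Hypothesis A_adj : adjoint ip A Astar.

Lemma adjointC p z : ip (Astar p) z = dotv (A z) p.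
Proof. by rewrite ipC A_adj. Qed.

Lemma adjointB p q : Astar p - Astar q = Astar (p - q).
Proof.
apply/eqP; rewrite -subr_eq0 -normr_eq0 -sqrf_eq0 -ip_norm.
by rewrite 2!ipDl !ipNl !adjointC !dotvE; apply/eqP; ring.
Qed.

(** The i-th coordinate of A z is the inner product of z with the image of the
    i-th basis vector under the adjoint; this bounds A without appeal to its
    continuity. *)
Lemma opnorm_has_sup : has_sup [set enorm (A z) | z in [set z | `|z| <= 1]].
Proof.
split; first by exists (enorm (A 0)), 0; rewrite //= normr0 ler01.
exists (Num.sqrt (\sum_i `|Astar (delta_mx 0 i)| ^+ 2)) => _ [z /= z1 <-].
apply: ler_wsqrtr; apply: ler_sum => i _; rewrite -expr2.
have -> : A z 0 i = ip z (Astar (delta_mx 0 i)).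
  rewrite A_adj /dotv (bigD1 i) //= mxE !eqxx mulr1 big1 ?addr0 // => j ji.
  by rewrite mxE (negbTE ji) andbF mulr0.
rewrite -(real_normK (num_real _)) ler_pXn2r ?nnegrE //.
by apply: (le_trans (ip_norm_le ip_norm _ _)); rewrite ler_piMl.
Qed.

Lemma opnorm_ge0 : 0 <= opnorm A.
Proof.
apply: (le_trans (enorm_ge0 (A 0))); apply: ub_le_sup.
  by case: opnorm_has_sup.
by exists 0; rewrite //= normr0 ler01.
Qed.

Lemma opnorm_ub z : enorm (A z) <= opnorm A * `|z|.
Proof.
have [->|z_neq0] := eqVneq z 0.
  rewrite linear0 normr0 mulr0 /enorm /dotv big1 ?sqrtr0 // => i _.
  by rewrite mxE mul0r.
have z_gt0 : 0 < `|z| by rewrite normr_gt0.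
rewrite -ler_pdivrMr //.
have -> : enorm (A z) / `|z| = enorm (A (`|z|^-1 *: z)).
  rewrite linearZ /enorm dotvZl dotvZr mulrA -expr2 sqrtrM ?sqr_ge0 //.
  by rewrite sqrtr_sqr ger0_norm ?invr_ge0 // mulrC.
apply: ub_le_sup; first by case: opnorm_has_sup.
by exists (`|z|^-1 *: z); rewrite //= normrZ ger0_norm ?invr_ge0 // mulVf // gt_eqF.
Qed.

Lemma adjoint_norm q : `|Astar q| <= opnorm A * enorm q.
Proof.
have [->|q_neq0] := eqVneq (Astar q) 0.
  by rewrite normr0 mulr_ge0 ?opnorm_ge0 ?enorm_ge0.
have q_gt0 : 0 < `|Astar q| by rewrite normr_gt0.
rewrite -(ler_pM2r q_gt0) -expr2 -ip_norm adjointC.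
apply: (le_trans (dotv_Cauchy_Schwarz _ _)).
by rewrite mulrAC ler_wpM2r ?enorm_ge0 // opnorm_ub.
Qed.

Section AugmentedLagrangian.
Hypothesis E_fin : @finite_dimensional R E.
Variables (psis : E -> R) (Lbar : R) (b : 'rV[R]_m) (c : R) (p : 'rV[R]_m).
Hypothesis psis_smooth : convex_smooth ip psis Lbar.
Hypothesis c_ge0 : 0 <= c.

Let penalty (z : E) : R := dotv p (A z - b) + c / 2 * enorm (A z - b) ^+ 2.

Let penaltyD z v : penalty (z + v) =
  penalty z + ip (Astar (p + c *: (A z - b))) v + c / 2 * enorm (A v) ^+ 2.
Proof.
rewrite /penalty adjointC !sqr_enorm linearD !dotvE.
by rewrite (dotvC (A v) (A z)) (dotvC (A v) p) (dotvC (A v) b) (dotvC b (A z)); field.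
Qed.

Let aug_is_diff z : is_diff z (aug_lagrangian psis A b c p)
  (('d psis z : E -> R) + (ip (Astar (p + c *: (A z - b))) : E -> R)).
Proof.
have -> : aug_lagrangian psis A b c p = psis + penalty.
  by apply/funext => u; rewrite fctE /penalty /aug_lagrangian addrA.
apply: is_diffD; first by apply: differentiableP; case: psis_smooth.
apply: (@quadratic_is_diff _ _ _ ip_norm _ _ _ (c / 2 * opnorm A ^+ 2)) => v.
rewrite penaltyD; rewrite (_ : _ - _ - _ = c / 2 * enorm (A v) ^+ 2); last by ring.
rewrite ger0_norm; last by rewrite mulr_ge0 ?divr_ge0 ?sqr_ge0.
rewrite -[leRHS]mulrA -exprMn.
rewrite ler_wpM2l ?divr_ge0 // ler_pXn2r ?nnegrE ?mulr_ge0 ?opnorm_ge0 ?enorm_ge0 //.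
exact: opnorm_ub.
Qed.

(** This identity is what makes the multiplier update p + c (A z - b) natural:
    the gradient is that of the plain Lagrangian at the updated multiplier. *)
Lemma grad_aug_lagrangian z : grad ip (aug_lagrangian psis A b c p) z =
  grad ip psis z + Astar (p + c *: (A z - b)).
Proof.
apply: grad_eq => // v; rewrite (@diff_val _ _ _ _ _ _ _ (aug_is_diff z)).
by rewrite fctE (gradE ip_norm) // ipDl.
Qed.

Lemma aug_lagrangian_smooth :
  convex_smooth ip (aug_lagrangian psis A b c p) (Lbar + c * opnorm A ^+ 2).
Proof.
have [psis_cvx psis_diff psis_lip] := psis_smooth; split.
- apply/convex_functionP => x y t t01.
  have := (convex_functionP psis).1 psis_cvx x y t t01.
  have -> : t *: x + (1 - t) *: y = x + (1 - t) *: (y - x).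
    have {1}-> : t = 1 - (1 - t) by ring.
    by rewrite scalerBl scale1r scalerBr addrAC addrA.
  have : penalty (x + (1 - t) *: (y - x)) <= t * penalty x + (1 - t) * penalty y.
    have := penaltyD x (y - x); rewrite [x + _]addrC subrK => ->.
    rewrite penaltyD [A (_ *: _)]linearZ /= !sqr_enorm ipZr dotvZl dotvZr.
    move: t01 => /andP[t0 t1]; have s0 : 0 <= 1 - t by rewrite subr_ge0.
    have := mulr_ge0 (mulr_ge0 t0 s0) (mulr_ge0 c_ge0 (dotv_ge0 (A (y - x)))).
    move: (dotv (A _) (A _)) => Q; lra.
  rewrite /penalty /aug_lagrangian; lra.
- by move=> z; exact: (@ex_diff _ _ _ _ _ _ _ (aug_is_diff z)).
- move=> x y; rewrite !grad_aug_lagrangian.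
  have -> : grad ip psis x + Astar (p + c *: (A x - b)) -
            (grad ip psis y + Astar (p + c *: (A y - b))) =
            (grad ip psis x - grad ip psis y) + Astar (c *: A (x - y)).
    rewrite opprD addrACA adjointB; congr (_ + Astar _).
    rewrite opprD addrACA subrr add0r -scalerBr [A (x - y)]linearB.
    by rewrite opprB addrA subrK.
  apply: (le_trans (ler_normD _ _)); rewrite mulrDl lerD //.
  apply: (le_trans (adjoint_norm _)).
  rewrite /enorm dotvZl dotvZr mulrA -expr2 sqrtrM ?sqr_ge0 // sqrtr_sqr.
  rewrite ger0_norm // -/(enorm _) mulrCA -mulrA ler_wpM2l // expr2 -mulrA.
  by rewrite ler_wpM2l ?opnorm_ge0 // opnorm_ub.
Qed.

End AugmentedLagrangian.

End Adjoint.

(** * Minimizers of a smooth plus a closed convex function *)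

Lemma seq_minimum (R : realDomainType) (T : eqType) (F : T -> R) (s : seq T) x :
  exists2 y, y \in x :: s &
  forall z, z \in x :: s -> F y <= F z.
Proof.
elim: s => [|z s [y ys ymin]].
  by exists x => [|z]; rewrite ?inE // => /eqP ->.
have [yz|zy] := leP (F y) (F z).
  exists y => [|w]; first by move: ys; rewrite !inE => /orP[] ->; rewrite ?orbT.
  rewrite !inE => /or3P[wx|/eqP ->|ws] //; apply: ymin; rewrite inE ?wx //.
  by rewrite ws orbT.
exists z => [|w]; first by rewrite !inE eqxx orbT.
rewrite !inE => /or3P[wx|/eqP ->|ws] //; apply: (le_trans (ltW zy)); apply: ymin.
  by rewrite inE wx.
by rewrite inE ws orbT.
Qed.

Section ProperConvex.
Context {R : realType} {E : normedModType R}.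
Variable h : E -> \bar R.
Hypothesis h_cpc : closed_proper_convex h.
Implicit Types (G : E -> R) (x y u : E).

Lemma edom_fin x : edom h x -> h x = (fine (h x))%:E.
Proof.
move: h_cpc => [_ [h_ny _] _] hx; rewrite fineK // fin_numElt.
by rewrite h_ny hx.
Qed.

Lemma fine_edom_convex x y t : edom h x -> edom h y -> 0 <= t <= 1 ->
  edom h (t *: x + (1 - t) *: y) /\
  fine (h (t *: x + (1 - t) *: y)) <= t * fine (h x) + (1 - t) * fine (h y).
Proof.
move=> hx hy t01; move: h_cpc => [_ _ /(_ x y t t01)].
rewrite (edom_fin hx) (edom_fin hy) => hxy.
have hz : edom h (t *: x + (1 - t) *: y).
  by apply: (le_lt_trans hxy); rewrite -!EFinM -EFinD ltry.
by split=> //; move: hxy; rewrite (edom_fin hz) -!EFinM -EFinD lee_fin.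
Qed.

(** Minimization of an extended-real objective becomes a family of inequalities
    between reals on the domain, where all later estimates take place. *)
Lemma argminP G x :
  is_argmin (fun u => ((G u)%:E + h u)%E) x <->
  edom h x /\ forall u, edom h u -> G x + fine (h x) <= G u + fine (h u).
Proof.
split=> [xmin|[hx xmin] u].
  have hx : edom h x.
    move: h_cpc => [_ [h_ny [u hu]] _]; have := xmin u.
    rewrite (edom_fin hu) -EFinD => /le_lt_trans/(_ (ltry _)).
    by rewrite /edom /=; case: (h x) => [r||]; rewrite ?ltry ?addey ?ltNyr.
  split=> // u hu; have := xmin u.
  by rewrite (edom_fin hx) (edom_fin hu) -!EFinD lee_fin.
have [hu|] := pselect (edom h u).
  by rewrite (edom_fin hx) (edom_fin hu) -!EFinD lee_fin xmin.
by rewrite /edom /= ltey => /negP; rewrite negbK => /eqP ->; rewrite addey // leey.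
Qed.

Lemma lsc_add_continuous G : continuous G ->
  lower_semicontinuous (fun u => ((G u)%:E + h u)%E).
Proof.
move=> G_cont x a aF; have [h_lsc [h_ny _] _] := h_cpc.
have [e e0 ae] : exists2 e : R, 0 < e & ((a - G x + e)%:E < h x)%E.
  move: aF (h_ny x); case: (h x) => [r||] aF; last by rewrite ltxx.
    move=> _.
    move: aF; rewrite -EFinD lte_fin => aF.
    by exists ((G x + r - a) / 2); rewrite ?lte_fin; lra.
  by exists 1; rewrite ?ltr01 ?ltry.
have [V xV Vh] := h_lsc x _ ae.
exists (V `&` [set y | G x - e < G y]) => [|y [Vy /= Gy]].
  apply: filterI => //; apply: (@cvgr_gt _ _ _ _ G (G x)).
    exact: G_cont.
  by rewrite ltrBlDr ltrDl.
move: (Vh _ Vy) (h_ny y); case: (h y) => [r||]; last by rewrite ltxx.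
  by rewrite -EFinD !lte_fin; lra.
by move=> _ _; rewrite addey // ltry.
Qed.

(** Without a minimizer, the sets where F exceeds F y, for y in the domain,
    would be an open cover of it; the point of a finite subcover with the
    smallest value is covered by none of them. *)
Lemma argmin_exists G : continuous G -> compact (edom h) ->
  exists x, is_argmin (fun u => ((G u)%:E + h u)%E) x.
Proof.
move=> G_cont; rewrite compact_cover => C_cov; apply: contrapT => no_min.
pose F u := G u + fine (h u).
pose U y := [set x | ((F y)%:E < (G x)%:E + h x)%E].
have U_open y : edom h y -> open (U y).
  by move=> _; apply/(lower_semicontinuousP _).1/lsc_add_continuous.
have UE x y : edom h x -> U y x <-> F y < F x.
  by move=> hx; rewrite /U /= (edom_fin hx) -EFinD lte_fin.
have C_sub : edom h `<=` \bigcup_(y in edom h) U y.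
  move=> x hx; apply: contrapT => nUx; apply: no_min; exists x; apply/argminP.
  split=> // y hy; rewrite leNgt; apply/negP => yx; apply: nUx.
  by exists y => //; apply/UE.
have [D DC C_subD] := C_cov _ _ _ U_open C_sub.
have [_ [_ [x0 hx0]] _] := h_cpc.
have [y0 y0D _] := C_subD _ hx0.
have [y yD ymin] := seq_minimum F (enum_fset D) y0.
have memD z : z \in y0 :: enum_fset D -> z \in D.
  by rewrite inE => /predU1P[->|].
have hy : edom h y by apply/set_mem/DC/memD.
have [z zD /(UE _ _ hy)] := C_subD _ hy.
by rewrite ltNge ymin // inE; apply/orP; right.
Qed.

End ProperConvex.

Section Growth.
Context {R : realType} {E : normedModType R} (ip : {dot E for idfun}).
Hypothesis ip_norm : inner_product_norm ip.
Variable h : E -> \bar R.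
Hypothesis h_cpc : closed_proper_convex h.
Implicit Types (G : E -> R) (x y u : E).

Lemma sqnorm_conv (t : R) x y c : `|t *: x + (1 - t) *: y - c| ^+ 2 =
  t * `|x - c| ^+ 2 + (1 - t) * `|y - c| ^+ 2 - t * (1 - t) * `|x - y| ^+ 2.
Proof.
rewrite !(sqnormB ip_norm) (sqnormD ip_norm) !normrZ !exprMn.
rewrite !real_normK ?num_real // !ipE.
by ring.
Qed.

(** Strong convexity of proximal subproblems. Two quadratic terms with free
    coefficients cover the regularized objective and both subproblems of
    backtracking at once. Comparing x with t u + (1 - t) x gives the claim with
    an extra factor 1 - t, and t is then taken small. *)
Lemma argmin_growth G (s M : R) (c d : E) x u :
  (forall y z t, 0 <= t <= 1 ->
     G (t *: y + (1 - t) *: z) <= t * G y + (1 - t) * G z) ->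
  is_argmin (fun u => ((G u + s / 2 * `|u - c| ^+ 2 + M * `|u - d| ^+ 2)%:E
                         + h u)%E) x ->
  edom h u ->
  G x + s / 2 * `|x - c| ^+ 2 + M * `|x - d| ^+ 2 + fine (h x)
    + (s / 2 + M) * `|u - x| ^+ 2 <=
  G u + s / 2 * `|u - c| ^+ 2 + M * `|u - d| ^+ 2 + fine (h u).
Proof.
move=> G_cvx /(argminP h_cpc)[hx xmin] hu.
set Fx := _ + fine (h x); set Fu := _ + fine (h u).
set K := _ * `|u - x| ^+ 2.
have FxFu : Fx <= Fu by apply: xmin.
have chord t : 0 < t -> t <= 1 -> K * (1 - t) <= Fu - Fx.
  move=> t0 t1; have t01 : 0 <= t <= 1 by rewrite ltW.
  have [hz hz_le] := fine_edom_convex h_cpc hu hx t01.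
  have := xmin _ hz; have := G_cvx u x t t01.
  rewrite !sqnorm_conv -[_ <= Fu - Fx](ler_pM2l t0) /Fx /Fu /K.
  by move: hz_le; lra.
clearbody Fx Fu K.
rewrite -lerBrDl leNgt; apply/negP => ltK.
have K0 : 0 < K by lra.
have := chord ((K - (Fu - Fx)) / (2 * K)).
have -> : K * (1 - (K - (Fu - Fx)) / (2 * K)) = K - (K - (Fu - Fx)) / 2.
  by field; rewrite gt_eqF.
have t0 : 0 < (K - (Fu - Fx)) / (2 * K) by apply: divr_gt0; lra.
have t1 : (K - (Fu - Fx)) / (2 * K) <= 1 by rewrite ler_pdivrMr; lra.
by move=> /(_ t0 t1); lra.
Qed.

End Growth.

(** * One stage of accumulative regularization *)

Section AccumulativeRegularization.
Context {R : realType} {E : normedModType R} (ip : {dot E for idfun}).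
Hypothesis ip_norm : inner_product_norm ip.
Hypothesis E_fin : @finite_dimensional R E.
Variables (S : inner_solver (R := R) (E := E)) (cA : R) (q : nat).
Hypothesis cA_gt0 : 0 < cA.
Hypothesis S_spec : inner_solver_spec ip S cA q.
Variables (f : E -> R) (h : E -> \bar R) (L : R).
Hypothesis L_gt0 : 0 < L.
Hypothesis f_smooth : convex_smooth ip f L.
Hypothesis h_cpc : closed_proper_convex h.
Hypothesis h_cpt : compact (edom h).
Implicit Types (x y z u : E) (sigma M : R).

Let df := grad ip f.

Lemma sqdist_continuous (r : R) x : continuous (fun u => r * `|u - x| ^+ 2).
Proof.
move=> u; apply: cvgMr; rewrite expr2; apply: cvgM;
  by apply: cvg_norm; apply: cvgB; [exact: cvg_id|exact: cvg_cst].
Qed.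

Lemma reg_obj_argmin_exists sigma xbar :
  exists x, is_argmin (reg_obj f h sigma xbar) x.
Proof.
apply: argmin_exists => //; move=> u; apply: cvgD.
  by apply: differentiable_continuous; case: f_smooth.
exact: sqdist_continuous.
Qed.

Lemma bt_trial_exists sigma x xbar M :
  exists xpp xp, bt_trial ip f h sigma x xbar M xpp xp.
Proof.
have [|xpp xppP] := @argmin_exists _ _ _ h_cpc (fun u =>
    ip (df x) u + sigma / 2 * `|u - xbar| ^+ 2 + M * `|u - x| ^+ 2) _ h_cpt.
  move=> u; apply: cvgD; last exact: sqdist_continuous.
  apply: cvgD; last exact: sqdist_continuous.
  exact: continuous_ip.
have [|xp xpP] := @argmin_exists _ _ _ h_cpc (fun u =>
    ip (df x) u + M * `|u - x| ^+ 2) _ h_cpt.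
  move=> u; apply: cvgD; last exact: sqdist_continuous.
  exact: continuous_ip.
by exists xpp, xp.
Qed.

Lemma bt_accept_large x M xpp xp : 2 * L <= M -> bt_accept ip f x M xpp xp.
Proof.
move=> LM; split.
  have := convex_smooth_upper ip_norm E_fin x xpp f_smooth.
  have := ler_wpM2r (sqr_ge0 `|xpp - x|) LM; rewrite -/df; lra.
have [_ _ f_lip] := f_smooth; apply: (le_trans (f_lip _ _)).
by have L0 := L_gt0; rewrite ler_wpM2r //; lra.
Qed.

(** A rejected M is below 2 L, so doubling it never exceeds 4 L. *)
Lemma bt_loop_spec sigma x xbar M out n :
  bt_loop ip f h sigma x xbar M out n -> M <= 4 * L ->
  exists j xpp xp Ms, [/\ out = (xpp, xp, Ms), Ms = 2 ^+ j * M, Ms <= 4 * L,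
    n = (3 * j.+1)%N &
    bt_trial ip f h sigma x xbar Ms xpp xp /\ bt_accept ip f x Ms xpp xp].
Proof.
elim=> {M out n} [M xpp xp tr acc|M xpp xp out n tr rej _ IH] ML.
  by exists 0%N, xpp, xp, M; split; rewrite ?expr0 ?mul1r.
have M2L : 2 * M <= 4 * L.
  have [LM|LM] := leP (2 * L) M; last by lra.
  by case: rej; apply: bt_accept_large.
have [j [ypp [yp [Ms [-> -> MsL -> tr_acc]]]]] := IH M2L.
exists j.+1, ypp, yp, (2 ^+ j * (2 * M)); split=> //.
  by rewrite exprSr mulrA.
by rewrite [in RHS]mulnS.
Qed.

Lemma geometric_exceeds (r : nat) M K : (1 < r)%N -> 0 < M ->
  exists k, K <= r%:R ^+ k * M.
Proof.
move=> r1 M0; exists (Num.bound `|K / M|); rewrite -ler_pdivrMr //.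
apply: (le_trans (ler_norm _)); apply: (le_trans (ltW (archi_boundP (normr_ge0 _)))).
by rewrite -natrX ler_nat ltnW // ltn_expl.
Qed.

Lemma bt_loop_exists sigma x xbar M : 0 < M ->
  exists out n, bt_loop ip f h sigma x xbar M out n.
Proof.
move=> M0; have [k] := geometric_exceeds (2 * L) (isT : (1 < 2)%N) M0.
elim: k M M0 => [|k IH] M M0 Mk.
  have [xpp [xp tr]] := bt_trial_exists sigma x xbar M.
  rewrite expr0 mul1r in Mk.
  by exists (xpp, xp, M), 3%N; apply: bt_stop => //; apply: bt_accept_large.
have [xpp [xp tr]] := bt_trial_exists sigma x xbar M.
have [acc|rej] := pselect (bt_accept ip f x M xpp xp).
  by exists (xpp, xp, M), 3%N; apply: bt_stop.
have M0' : 0 < 2 * M by rewrite mulr_gt0.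
have [|out [n loop]] := IH _ M0'; first by rewrite mulrA -exprSr.
by exists out, (3 + n)%N; apply: bt_next tr rej loop.
Qed.

Lemma solver_est_bounds sigma xbar x k : 0 < sigma -> edom h x -> (0 < k)%N ->
  0 <= sol_est S f h sigma xbar x k <= cA * L.
Proof.
by move=> s0 hx k0; have [] := S_spec xbar L_gt0 f_smooth h_cpc h_cpt s0 hx k0.
Qed.

Lemma solver_test_large sigma xbar x k : 0 < sigma -> edom h x -> (0 < k)%N ->
  8 * Num.sqrt (2 * sol_est S f h sigma xbar x k / sigma) <=
  8 * Num.sqrt (2 * cA) * Num.sqrt (L / sigma).
Proof.
move=> s0 hx k0; rewrite -[leRHS]mulrA ler_wpM2l // -sqrtrM; last first.
  by rewrite mulr_ge0 // ltW.
have /andP[_ estL] := solver_est_bounds xbar s0 hx k0.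
apply: ler_wsqrtr; rewrite mulrA ler_pM2r ?invr_gt0 //.
by rewrite -mulrA ler_pM2l.
Qed.

(** The termination test amounts to L_k / k^2 <= sigma / 128, so the guarantee of
    the solver and the sigma-strong convexity of the objective divide the
    distance to the minimizer by 8. The test is met at the latest when k passes
    8 sqrt (2 cA L / sigma). *)
Lemma solver_call_spec sigma xbar x xs n : 0 < sigma -> edom h x ->
  solver_call S f h sigma xbar x xs n ->
  [/\ edom h xs,
      forall y, is_argmin (reg_obj f h sigma xbar) y -> `|xs - y| <= `|x - y| / 8 &
      n%:R <= (1 + q%:R) * (8 * Num.sqrt (2 * cA) * Num.sqrt (L / sigma) + 1)].
Proof.
move=> s0 hx [k [k0 test_k first_k -> ->]].
have [hxs /andP[est0 _] res_le gap] :=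
  S_spec xbar L_gt0 f_smooth h_cpc h_cpt s0 hx k0.
split=> // [y ymin|].
  have /(argminP h_cpc)[hy _] := ymin.
  have := gap y ymin; rewrite /reg_obj (edom_fin h_cpc hxs) (edom_fin h_cpc hy).
  rewrite -!EFinD lee_fin => gap_le.
  have f_cvx : forall u v t, 0 <= t <= 1 ->
      f (t *: u + (1 - t) *: v) <= t * f u + (1 - t) * f v.
    by apply/convex_functionP; case: f_smooth.
  (* There is one quadratic term here; the other one gets coefficient 0. *)
  have ymin' : is_argmin (fun u => ((f u + sigma / 2 * `|u - xbar| ^+ 2
      + 0 * `|u - 0| ^+ 2)%:E + h u)%E) y.
    by move=> u; rewrite !mul0r !addr0; apply: ymin.
  have growth := argmin_growth ip_norm h_cpc f_cvx ymin' hxs.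
  set Lk := sol_est S f h sigma xbar x k in gap_le est0 test_k *.
  have Lk_le : Lk / k%:R ^+ 2 <= sigma / 128.
    have k2 : 0 < k%:R ^+ 2 :> R by rewrite exprn_gt0 // ltr0n.
    (* 128 is 8 squared times the factor 2 under the root of the test. *)
    have : (8 * Num.sqrt (2 * Lk / sigma)) ^+ 2 <= k%:R ^+ 2.
      by rewrite ler_pXn2r ?nnegrE ?mulr_ge0 ?sqrtr_ge0.
    rewrite exprMn sqr_sqrtr; last by rewrite divr_ge0 ?mulr_ge0 // ltW.
    rewrite ler_pdivrMr // mulrA ler_pdivrMr //; lra.
  rewrite -(@ler_pXn2r _ 2) ?nnegrE ?divr_ge0 // -(ler_pM2l s0) expr_div_n.
  have := ler_wpM2r (sqr_ge0 `|x - y|) Lk_le.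
  rewrite ?mul0r in growth; lra.
have k_le : k%:R <= 8 * Num.sqrt (2 * cA) * Num.sqrt (L / sigma) + 1.
  have [k1|k1] := leqP k 1.
    apply: (@le_trans _ _ 1); first by rewrite (ler_nat _ k 1).
    by rewrite lerDr !mulr_ge0 ?sqrtr_ge0.
  have k10 : (0 < k.-1)%N by rewrite -ltnS prednK.
  have := first_k k.-1; rewrite k10 ltn_predL k0 -ltNge => /(_ isT) ltk.
  rewrite -[k]prednK // -natr1 lerD2r; apply: (le_trans (ltW ltk)).
  exact: solver_test_large.
apply: (@le_trans _ _ ((1 + q%:R) * k%:R)); last by rewrite ler_wpM2l // addr_ge0.
have -> : (1 + q%:R) * k%:R = (k + q * k)%:R :> R by rewrite natrD natrM; ring.
by rewrite ler_nat leq_add2l.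
Qed.

Lemma solver_call_exists sigma xbar x : 0 < sigma -> edom h x ->
  exists xs n, solver_call S f h sigma xbar x xs n.
Proof.
move=> s0 hx; set T := 8 * Num.sqrt (2 * cA) * Num.sqrt (L / sigma).
pose test k := 8 * Num.sqrt (2 * sol_est S f h sigma xbar x k / sigma) <= k%:R.
have : exists k, (0 < k)%N && test k.
  exists (Num.bound T).+1; rewrite /test /=.
  apply: (le_trans (solver_test_large xbar s0 hx (ltn0Sn _))).
  apply: (@le_trans _ _ (Num.bound T)%:R); last by rewrite ler_nat.
  by apply/ltW/archi_boundP; rewrite !mulr_ge0 ?sqrtr_ge0.
move=> /ex_minnP[k /andP[k0 tk] kmin].
exists (sol_iter S f h sigma xbar x k), (k + sol_res S f h sigma xbar x k)%N, k.
split=> // j /andP[j0 jk]; apply/negP => tj; move: jk; rewrite ltnNge.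
by rewrite kmin ?j0.
Qed.

Lemma bt_step_growth sigma x xbar M xpp xp :
  bt_trial ip f h sigma x xbar M xpp xp ->
  [/\ edom h xpp, edom h xp,
    forall u, edom h u ->
      ip (df x) xpp + sigma / 2 * `|xpp - xbar| ^+ 2 + M * `|xpp - x| ^+ 2
        + fine (h xpp) + (sigma / 2 + M) * `|u - xpp| ^+ 2 <=
      ip (df x) u + sigma / 2 * `|u - xbar| ^+ 2 + M * `|u - x| ^+ 2 + fine (h u) &
    forall u, edom h u ->
      ip (df x) xp + M * `|xp - x| ^+ 2 + fine (h xp) + M * `|u - xp| ^+ 2 <=
      ip (df x) u + M * `|u - x| ^+ 2 + fine (h u)].
Proof.
move=> [xppP xpP].
have ip_cvx : forall u v t, 0 <= t <= 1 ->
    ip (df x) (t *: u + (1 - t) *: v) <= t * ip (df x) u + (1 - t) * ip (df x) v.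
  by move=> u v t _; rewrite !ipE.
have [[hxpp _] [hxp _]] := ((argminP h_cpc _ _).1 xppP, (argminP h_cpc _ _).1 xpP).
split=> // u hu; first exact: (argmin_growth ip_norm h_cpc ip_cvx xppP hu).
have xpP' : is_argmin (fun u => ((ip (df x) u + 0 / 2 * `|u - 0| ^+ 2
      + M * `|u - x| ^+ 2)%:E + h u)%E) xp.
  by move=> v; rewrite !mul0r !addr0; apply: xpP.
by have := argmin_growth ip_norm h_cpc ip_cvx xpP' hu; rewrite !mul0r !addr0 add0r.
Qed.

(** The first-order optimality condition of the second backtracking subproblem,
    read off its quadratic growth. *)
Lemma arl_residual_subgradient sigma x xbar M xpp xp :
  bt_trial ip f h sigma x xbar M xpp xp ->
  subdiff ip h xp (arl_residual ip f x xp M - df xp).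
Proof.
move=> tr; have [_ hxp _ growth] := bt_step_growth tr.
split=> // u; have [hu|] := pselect (edom h u); last first.
  by rewrite /edom /= ltey => /negP; rewrite negbK => /eqP ->; rewrite leey.
rewrite (edom_fin h_cpc hxp) (edom_fin h_cpc hu) -EFinD lee_fin.
have := growth u hu; rewrite /arl_residual -/df addrK.
rewrite !(sqnormB ip_norm) !ipE !ip_norm (ipC ip u xp) (ipC ip x u) (ipC ip x xp).
lra.
Qed.

(** With d the distance from x to the minimizer y of the regularized objective:
    the growth of that objective and of the first subproblem keep xpp within
    3 d / 2 of x and within d of y; the two subproblems differ by the proximal
    term only, so 2 M |xp - xpp| <= sigma |xpp - xbar|. The residual is at most
    3 M |x - xp|. *)
Lemma arl_residual_norm sigma x xbar M xpp xp y :
  0 < M <= sigma ->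
  bt_trial ip f h sigma x xbar M xpp xp -> bt_accept ip f x M xpp xp ->
  is_argmin (reg_obj f h sigma xbar) y ->
  `|arl_residual ip f x xp M| <= 6 * sigma * `|x - y| + 3 / 2 * (sigma * `|y - xbar|).
Proof.
move=> /andP[M0 Ms] tr [acc1 acc2] /(argminP h_cpc)[hy ymin].
have [hxpp hxp growpp growp] := bt_step_growth tr.
have [f_cvx f_diff _] := f_smooth.
have tri u v w : `|u - w| <= `|u - v| + `|v - w| by exact: ler_distD.
(* The growth of the first subproblem at y, the optimality of y, the gradient
   inequality and the first acceptance test, added up. *)
have xpp_near : M / 2 * `|xpp - x| ^+ 2 + M * `|xpp - y| ^+ 2 <= M * `|x - y| ^+ 2.
  have := growpp y hy; have := ymin _ hxpp.
  have := gradient_inequality ip_norm E_fin y f_cvx (f_diff x).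
  move: acc1; rewrite -/df !ipE (distrC y xpp) (distrC y x).
  have := sqr_ge0 `|xpp - y|; have : 0 <= sigma by lra.
  move=> s0 /(mulr_ge0 s0); lra.
have xpp_x : `|xpp - x| <= 3 / 2 * `|x - y|.
  rewrite -(@ler_pXn2r _ 2) ?nnegrE ?mulr_ge0 // -(ler_pM2l M0).
  have := mulr_ge0 (ltW M0) (sqr_ge0 `|xpp - y|).
  have := mulr_ge0 (ltW M0) (sqr_ge0 `|x - y|).
  rewrite exprMn; lra.
have xpp_y : `|xpp - y| <= `|x - y|.
  rewrite -(@ler_pXn2r _ 2) ?nnegrE // -(ler_pM2l M0).
  have := mulr_ge0 (ltW M0) (sqr_ge0 `|xpp - x|); lra.
(* The growth of each subproblem at the minimizer of the other. *)
have xp_xpp : 2 * M * `|xp - xpp| <= sigma * `|xpp - xbar|.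
  have [->|w_neq0] := eqVneq `|xp - xpp| 0.
    by rewrite mulr0 mulr_ge0 //; lra.
  have w0 : 0 < `|xp - xpp| by rewrite lt_def w_neq0 normr_ge0.
  rewrite -(ler_pM2r w0).
  have s0 : 0 <= sigma / 2 by lra.
  have : `|xp - xbar| ^+ 2 <= (`|xp - xpp| + `|xpp - xbar|) ^+ 2.
    by rewrite ler_pXn2r ?nnegrE ?addr_ge0.
  move=> /(ler_wpM2l s0); have := growpp xp hxp; have := growp xpp hxpp.
  rewrite (distrC xpp xp); lra.
have res_le : `|arl_residual ip f x xp M| <= 3 * M * `|x - xp|.
  rewrite /arl_residual -addrA (addrC (- _)); apply: (le_trans (ler_normD _ _)).
  rewrite normrZ ger0_norm; last by lra.
  move: acc2; rewrite (distrC xp x) -/df; lra.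
apply: (le_trans res_le).
have : `|x - xp| <= 3 / 2 * `|x - y| + `|xp - xpp|.
  have := tri x xpp xp; rewrite (distrC x xpp) (distrC xpp xp); lra.
move=> /(ler_wpM2l (ltW M0)).
have : M * `|x - y| <= sigma * `|x - y| by rewrite ler_wpM2r.
have : sigma * `|xpp - xbar| <= sigma * (`|x - y| + `|y - xbar|).
  by apply: ler_wpM2l; [lra | have := tri xpp y xbar; lra].
lra.
Qed.

(** The new center is chosen so that the new objective is, up to a constant, the
    old one plus (3 sigma / 2) |u - xs|^2. Comparing both objectives at both
    minimizers shows that the minimizer moves towards xs, and by no more than
    its previous distance to xs. *)
Lemma prox_center_shift sigma xbar xs y z : 0 < sigma ->
  let gamma := 1 - sigma / (4 * sigma) in
  let xbar' := (1 - gamma) *: xbar + gamma *: xs in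
  is_argmin (reg_obj f h sigma xbar) y ->
  is_argmin (reg_obj f h (4 * sigma) xbar') z ->
  `|xs - z| <= `|xs - y| /\
  4 * sigma * `|z - xbar'| <= sigma * `|y - xbar| + 4 * sigma * `|xs - y|.
Proof.
move=> s0 gamma; have -> : gamma = 1 - 1 / 4 by rewrite /gamma; field; rewrite gt_eqF.
have -> : 1 - (1 - 1 / 4) = 1 / 4 :> R by field.
set xbar' := _ + _ => /= ymin zmin.
have f_cvx : forall u v t, 0 <= t <= 1 ->
    f (t *: u + (1 - t) *: v) <= t * f u + (1 - t) * f v.
  by apply/convex_functionP; case: f_smooth.
have growth s c w : is_argmin (reg_obj f h s c) w -> forall u, edom h u ->
    f w + s / 2 * `|w - c| ^+ 2 + fine (h w) + s / 2 * `|u - w| ^+ 2 <=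
    f u + s / 2 * `|u - c| ^+ 2 + fine (h u).
  move=> wmin u hu.
  have wmin' : is_argmin (fun u => ((f u + s / 2 * `|u - c| ^+ 2
      + 0 * `|u - 0| ^+ 2)%:E + h u)%E) w.
    by move=> v; rewrite !mul0r !addr0; apply: wmin.
  by have := argmin_growth ip_norm h_cpc f_cvx wmin' hu; rewrite !mul0r !addr0.
have /(argminP h_cpc)[hy _] := ymin; have /(argminP h_cpc)[hz _] := zmin.
have center u : `|u - xbar'| ^+ 2 =
    1 / 4 * `|u - xbar| ^+ 2 + 3 / 4 * `|u - xs| ^+ 2 - 3 / 16 * `|xbar - xs| ^+ 2.
  have := sqnorm_conv ip_norm (1 / 4) xbar xs u.
  rewrite -/xbar' (distrC u) (distrC u) (distrC u); lra.
have key : 5 * `|y - z| ^+ 2 <= 3 * (`|xs - y| ^+ 2 - `|xs - z| ^+ 2).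
  rewrite -(ler_pM2l s0); have := growth _ _ _ ymin z hz.
  have := growth _ _ _ zmin y hy; rewrite !center (distrC xs) (distrC xs) (distrC z y).
  lra.
have xs_z : `|xs - z| <= `|xs - y|.
  rewrite -(@ler_pXn2r _ 2) ?nnegrE //; have := sqr_ge0 `|y - z|; lra.
have y_z : `|z - y| <= `|xs - y|.
  rewrite -(@ler_pXn2r _ 2) ?nnegrE // (distrC z).
  have := sqr_ge0 `|y - z|; have := sqr_ge0 `|xs - z|; lra.
split=> //.
have : 4 * `|z - xbar'| <= `|y - xbar| + 4 * `|xs - y|.
  have -> : 4 * `|z - xbar'| = `|(y - xbar) + (z - y) + 3 *: (z - xs)|.
    rewrite -[4]ger0_norm // -normrZ; congr `| _ |.
    rewrite /xbar' scalerBr scalerDr !scalerA.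
    have -> : 4 * (1 / 4) = 1 :> R by field.
    have -> : 4 * (1 - 1 / 4) = 3 :> R by field.
    have -> : 4 = 1 + 3 :> R by ring.
    rewrite scalerDl !scale1r opprD addrACA scalerBr; congr (_ + _).
    by rewrite [RHS]addrC addrA subrK.
  apply: (le_trans (ler_normD _ _)); rewrite normrZ (ger0_norm (_ : 0 <= 3)) //.
  have := ler_normD (y - xbar) (z - y); rewrite (distrC z xs); lra.
move=> /(ler_wpM2l (ltW s0)); lra.
Qed.

End AccumulativeRegularization.

(** * Residual and cost of AR-L and PF-AR *)

Section ParameterFree.
Context {R : realType} {E : normedModType R} (ip : {dot E for idfun}).
Hypothesis ip_norm : inner_product_norm ip.
Hypothesis E_fin : @finite_dimensional R E.
Variables (S : inner_solver (R := R) (E := E)) (cA : R) (q : nat).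
Hypothesis cA_gt0 : 0 < cA.
Hypothesis S_spec : inner_solver_spec ip S cA q.
Variables (f : E -> R) (h : E -> \bar R) (L : R).
Hypothesis L_gt0 : 0 < L.
Hypothesis f_smooth : convex_smooth ip f L.
Hypothesis h_cpc : closed_proper_convex h.
Hypothesis h_cpt : compact (edom h).
Implicit Types (x y z u : E) (sigma M D : R).

Let df := grad ip f.

(** Evaluations of a stage of AR-L that neither grow with sqrt (L / sigma) nor
    are due to doublings: the last step of the solver with its resolvents, the
    accepted backtracking trial, and one gradient. *)
Definition stage_overhead : R := q%:R + 5.

(** Twice the rate of a single stage, for the geometric series over the stages;
    the second summand absorbs the overhead of all stages but the last. *)
Definition arl_rate : R :=
  2 * ((1 + q%:R) * (8 * Num.sqrt (2 * cA)) + 2 * stage_overhead).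

Lemma stage_overhead_ge0 : 0 <= stage_overhead.
Proof. by rewrite addr_ge0. Qed.

Lemma arl_rate_ge0 : 0 <= arl_rate.
Proof.
by rewrite mulr_ge0 // addr_ge0 // mulr_ge0 ?stage_overhead_ge0 ?addr_ge0 //
  mulr_ge0 ?sqrtr_ge0.
Qed.

Lemma arl_stage_cost sigma xbar x M xs xpp xp Ms n1 n2 :
  0 < sigma -> M <= 4 * L -> edom h x ->
  solver_call S f h sigma xbar x xs n1 ->
  backtracking ip f h sigma xs xbar M (xpp, xp, Ms) n2 ->
  exists j, [/\ Ms = 2 ^+ j * M, Ms <= 4 * L, edom h xs,
    bt_trial ip f h sigma xs xbar Ms xpp xp /\ bt_accept ip f xs Ms xpp xp &
    (n1 + n2)%:R <= (1 + q%:R) * (8 * Num.sqrt (2 * cA)) * Num.sqrt (L / sigma)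
                    + stage_overhead + 3 * j%:R].
Proof.
move=> s0 ML hx call [n' loop ->].
have [hxs _ n1_le] := solver_call_spec ip_norm cA_gt0 S_spec L_gt0
  f_smooth h_cpc h_cpt s0 hx call.
have [j [ypp [yp [Ns [[-> -> ->] NsE NsL -> tr]]]]] :=
  bt_loop_spec ip_norm E_fin L_gt0 f_smooth loop ML.
exists j; split=> //; rewrite natrD -natr1 natrM -natr1 /stage_overhead; lra.
Qed.

(** The hypothesis with B is the loop invariant: one stage divides the second
    term by 8, the next multiplies sigma by 4, and the shift of the center adds
    at most four times sigma times the reduced distance to the first term. For
    the cost, a stage that is not the last has sigma < 4 L, hence
    1 <= 2 sqrt (L / sigma), and the square root halves from stage to stage. *)
Lemma arl_loop_spec (B : R) sigma xbar x M out n :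
  arl_loop ip S f h sigma xbar x M out n ->
  0 < sigma -> 0 < M -> M <= 4 * L -> edom h x ->
  (exists2 y, is_argmin (reg_obj f h sigma xbar) y &
     sigma * `|y - xbar| + sigma * `|x - y| <= B) ->
  exists j x' v' M', [/\ out = (x', v', M') /\ edom h x',
    M' = 2 ^+ j * M /\ M' <= 4 * L, `|v'| <= 3 / 2 * B,
    subdiff ip h x' (v' - df x') &
    n%:R <= arl_rate * Num.sqrt (L / sigma) + stage_overhead + 3 * j%:R].
Proof.
have L0 := L_gt0; have c20 := stage_overhead_ge0; have rate0 := arl_rate_ge0.
have rateE : arl_rate = 2 * ((1 + q%:R) * (8 * Num.sqrt (2 * cA))) + 4 * stage_overhead.
  by rewrite /arl_rate; ring.
have c10 : 0 <= (1 + q%:R) * (8 * Num.sqrt (2 * cA)) :> R.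
  by rewrite mulr_ge0 ?addr_ge0 ?mulr_ge0 ?sqrtr_ge0.
elim=> {sigma xbar x M out n}
  [sigma xbar x M xs xpp xp Ms n1 n2 call bt Mss
  |sigma xbar x M xs xpp xp Ms n1 n2 out n call bt nMss sigma' gamma _ IH]
  s0 M0 ML hx [y ymin y_le].
- have [j [MsE MsL hxs [tr acc] n_le]] := arl_stage_cost s0 ML hx call bt.
  have [_ close _] := solver_call_spec ip_norm cA_gt0 S_spec L_gt0
  f_smooth h_cpc h_cpt s0 hx call.
  have Ms0 : 0 < Ms by rewrite MsE mulr_gt0 ?exprn_gt0.
  have Mss' : 0 < Ms <= sigma by rewrite Ms0.
  have sub := arl_residual_subgradient ip_norm h_cpc tr.
  have hxp : edom h xp by case: sub.
  exists j, xp, (arl_residual ip f xs xp Ms), Ms; split=> //.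
    have := arl_residual_norm ip_norm E_fin f_smooth h_cpc Mss' tr acc ymin.
    move=> /le_trans; apply.
    have := ler_wpM2l (ltW s0) (close y ymin).
    have := mulr_ge0 (ltW s0) (normr_ge0 (x - y)); lra.
  apply: (le_trans n_le); rewrite rateE.
  have := mulr_ge0 c10 (sqrtr_ge0 (L / sigma)).
  have := mulr_ge0 c20 (sqrtr_ge0 (L / sigma)); lra.
have [j [MsE MsL hxs _ n_le]] := arl_stage_cost s0 ML hx call bt.
have [_ close _] := solver_call_spec ip_norm cA_gt0 S_spec L_gt0
  f_smooth h_cpc h_cpt s0 hx call.
have Ms0 : 0 < Ms by rewrite MsE mulr_gt0 ?exprn_gt0.
have s4L : sigma < 4 * L by move: nMss; rewrite -ltNge => /lt_le_trans; apply.
have s0' : 0 < sigma' by rewrite mulr_gt0.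
have [z zmin] := reg_obj_argmin_exists f_smooth h_cpc h_cpt sigma'
  ((1 - gamma) *: xbar + gamma *: xs).
have [xs_z z_le] := prox_center_shift ip_norm f_smooth h_cpc s0 ymin zmin.
have [|k [x' [v' [M' [outE [M'E M'L] v'_le sub n'_le]]]]] := IH s0' Ms0 MsL hxs.
  exists z => //.
  have := ler_wpM2l (ltW s0) (close y ymin); have := ler_wpM2l (ltW s0) xs_z.
  move: z_le; rewrite -/gamma -/sigma' /sigma'; lra.
exists (k + j)%N, x', v', M'; split=> //.
  by split=> //; rewrite M'E MsE exprD mulrA.
have half : Num.sqrt (L / sigma') = Num.sqrt (L / sigma) / 2.
  have -> : L / sigma' = L / sigma * (1 / 2) ^+ 2.
    by rewrite /sigma'; field; rewrite gt_eqF.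
  rewrite sqrtrM ?divr_ge0 ?ltW // sqrtr_sqr ger0_norm; lra.
have one_le : 1 <= 2 * Num.sqrt (L / sigma).
  have : (1 / 2) ^+ 2 <= L / sigma by rewrite ler_pdivlMr //; lra.
  move=> /(ler_wsqrtr); rewrite sqrtr_sqr ger0_norm; lra.
rewrite (natrD _ _ n) (natrD _ k); move: n'_le; rewrite half rateE.
have := ler_wpM2l c20 one_le; lra.
Qed.

Lemma arl_stage_exists sigma xbar x M :
  0 < sigma -> 0 < M -> M <= 4 * L -> edom h x ->
  exists xs xpp xp Ms n1 n2, [/\ solver_call S f h sigma xbar x xs n1,
    backtracking ip f h sigma xs xbar M (xpp, xp, Ms) n2,
    0 < Ms, Ms <= 4 * L & edom h xs].
Proof.
move=> s0 M0 ML hx.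
have [xs [n1 call]] := solver_call_exists cA_gt0 S_spec L_gt0 f_smooth h_cpc
  h_cpt xbar s0 hx.
have [[[xpp xp] Ms] [n2 loop]] :=
  bt_loop_exists ip_norm E_fin L_gt0 f_smooth h_cpc h_cpt sigma xs xbar M0.
have bt : backtracking ip f h sigma xs xbar M (xpp, xp, Ms) n2.+1 by exists n2.
have [j [MsE MsL hxs _ _]] := arl_stage_cost s0 ML hx call bt.
exists xs, xpp, xp, Ms, n1, n2.+1; split=> //.
by rewrite MsE mulr_gt0 ?exprn_gt0.
Qed.

Lemma arl_loop_exists sigma xbar x M :
  0 < sigma -> 0 < M -> M <= 4 * L -> edom h x ->
  exists out n, arl_loop ip S f h sigma xbar x M out n.
Proof.
move=> s0; have [k] := geometric_exceeds (4 * L) (isT : (1 < 4)%N) s0.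
elim: k sigma s0 xbar x M => [|k IH] sigma s0 xbar x M sk M0 ML hx;
  have [xs [xpp [xp [Ms [n1 [n2 [call bt Ms0 MsL hxs]]]]]]] :=
    arl_stage_exists xbar s0 M0 ML hx.
  exists (xp, arl_residual ip f xs xp Ms, Ms), (n1 + n2)%N.
  by apply: arl_stop call bt _; apply: (le_trans MsL); rewrite expr0 mul1r in sk.
have [Mss|nMss] := boolP (Ms <= sigma).
  exists (xp, arl_residual ip f xs xp Ms, Ms), (n1 + n2)%N.
  exact: arl_stop call bt _.
have s0' : 0 < 4 * sigma by rewrite mulr_gt0.
have sk' : 4 * L <= 4 ^+ k * (4 * sigma) by rewrite mulrA -exprSr.
have [out [n next]] := IH _ s0'
  ((1 - (1 - sigma / (4 * sigma))) *: xbar + (1 - sigma / (4 * sigma)) *: xs)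
  xs Ms sk' Ms0 MsL hxs.
exists out, (n1 + n2 + n)%N; exact: arl_next call bt nMss next.
Qed.

Variable Dmax : R.
Hypothesis Dmax_ub : forall x y, edom h x -> edom h y -> `|x - y| <= Dmax.

Lemma AR_L_spec sigma x M out n : AR_L ip S f h x sigma M out n ->
  0 < sigma -> 0 < M -> M <= 4 * L -> edom h x ->
  exists j x' v' M', [/\ out = (x', v', M') /\ edom h x',
    M' = 2 ^+ j * M /\ M' <= 4 * L, `|v'| <= 3 * (sigma * Dmax),
    subdiff ip h x' (v' - df x') &
    n%:R <= arl_rate * Num.sqrt (L / sigma) + stage_overhead + 3 * j%:R].
Proof.
move=> run s0 M0 ML hx.
have -> : 3 * (sigma * Dmax) = 3 / 2 * (2 * (sigma * Dmax)) by field.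
apply: (arl_loop_spec run s0 M0 ML hx).
have [y ymin] := reg_obj_argmin_exists f_smooth h_cpc h_cpt sigma x.
exists y => //; have /(argminP h_cpc)[hy _] := ymin.
rewrite (distrC x y); have := ler_wpM2l (ltW s0) (Dmax_ub hy hx); lra.
Qed.

Variable eps : R.
Hypothesis eps_gt0 : 0 < eps.

(** The square root doubles with each guess of the diameter, so the cost of a
    call telescopes into the difference of its double at Dmax and its value at
    the first guess; T counts the guesses that failed. *)
Lemma PF_AR_cost x M D out n : PF_AR ip S f h eps x M D out n ->
  0 < M -> M <= 4 * L -> 0 < D -> D <= Dmax -> edom h x ->
  exists x' v' j T, [/\ out = (x', v') /\ edom h x', `|v'| <= eps,
    subdiff ip h x' (v' - df x'), 2 ^+ j * M <= 4 * L /\ 4 ^+ T * D <= Dmax &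
    n%:R <= arl_rate * (2 * Num.sqrt (28 * L * Dmax / eps)
               - Num.sqrt (28 * L * D / eps))
             + stage_overhead * (T%:R + 1) + 3 * j%:R].
Proof.
have L0 := L_gt0; have e0 := eps_gt0.
have c20 := stage_overhead_ge0; have rate0 := arl_rate_ge0.
have stage_sigma D' : 0 < D' -> 0 < eps / (7 * (4 * D')).
  by move=> ?; rewrite divr_gt0 ?mulr_gt0.
have stage_root D' : 0 < D' -> L / (eps / (7 * (4 * D'))) = 28 * L * D' / eps.
  by move=> D'0; field; rewrite !gt_eqF.
elim=> {x M D out n} [x M D x' v' M' n run v_le|x M D x' v' M' n out n' run v_gt _ IH]
  M0 ML D0 DDmax hx.
- have [j [_ [_ [_ [[[<- <- <-] hx'] [M'E M'L] _ sub n_le]]]]] :=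
    AR_L_spec run (stage_sigma _ D0) M0 ML hx.
  exists x', v', j, 0%N; split=> //; first by rewrite -M'E expr0 mul1r.
  apply: (le_trans n_le); rewrite stage_root // add0r mulr1 !lerD2r ler_wpM2l //.
  have : Num.sqrt (28 * L * D / eps) <= Num.sqrt (28 * L * Dmax / eps); last by lra.
  by apply: ler_wsqrtr; rewrite ler_pM2r ?invr_gt0 // ler_pM2l // mulr_gt0.
have [j [_ [_ [_ [[[<- <- <-] hx'] [M'E M'L] v_le sub n_le]]]]] :=
  AR_L_spec run (stage_sigma _ D0) M0 ML hx.
have D4 : 4 * D <= Dmax.
  move: v_gt; rewrite -ltNge => /lt_le_trans/(_ v_le).
  have -> : 3 * (eps / (7 * (4 * D)) * Dmax) = eps * (3 * Dmax) / (7 * (4 * D)).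
    by field; rewrite gt_eqF.
  rewrite ltr_pdivlMr ?mulr_gt0 // => lt1.
  have : eps * (7 * (4 * D)) < eps * (3 * Dmax) by lra.
  by rewrite ltr_pM2l //; lra.
have M'0 : 0 < M' by rewrite M'E mulr_gt0 ?exprn_gt0.
have D40 : 0 < 4 * D by rewrite mulr_gt0.
have [y [w [k [T [outE w_le sub' [kM TD] n'_le]]]]] := IH M'0 M'L D40 D4 hx'.
exists y, w, (k + j)%N, T.+1; split=> //.
  by rewrite exprD -mulrA -M'E; split=> //; rewrite exprSr -mulrA.
have dbl : Num.sqrt (28 * L * (4 * D) / eps) = 2 * Num.sqrt (28 * L * D / eps).
  have -> : 28 * L * (4 * D) / eps = 2 ^+ 2 * (28 * L * D / eps) by ring.
  by rewrite sqrtrM ?sqr_ge0 // sqrtr_sqr ger0_norm.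
rewrite (natrD _ n) (natrD _ k) -natr1; move: n'_le n_le.
by rewrite dbl stage_root //; lra.
Qed.

Lemma PF_AR_exists x M D : 0 < M -> M <= 4 * L -> 0 < D -> edom h x ->
  exists out n, PF_AR ip S f h eps x M D out n.
Proof.
have e0 := eps_gt0.
move=> M0 ML D0; have [k] := geometric_exceeds Dmax (isT : (1 < 4)%N) D0.
elim: k x M D M0 ML D0 => [|k IH] x M D M0 ML D0 Dk hx;
  have s0 : 0 < eps / (7 * (4 * D)) by rewrite divr_gt0 ?mulr_gt0.
  have [out [n run]] := arl_loop_exists x s0 M0 ML hx.
  have [j [x' [v' [M' [[outE hx'] _ v_le _ _]]]]] := AR_L_spec run s0 M0 ML hx.
  rewrite outE in run.
  exists (x', v'), n; apply: pfar_stop run _; apply: (le_trans v_le).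
  have -> : 3 * (eps / (7 * (4 * D)) * Dmax) = eps * (3 * Dmax) / (7 * (4 * D)).
    by field; rewrite gt_eqF.
  rewrite ler_pdivrMr ?mulr_gt0 //.
  rewrite expr0 mul1r in Dk; have := ler_wpM2l (ltW e0) Dk.
  have := mulr_gt0 e0 D0; lra.
have [out [n run]] := arl_loop_exists x s0 M0 ML hx.
have [j [x' [v' [M' [[outE hx'] [M'E M'L] _ _ _]]]]] := AR_L_spec run s0 M0 ML hx.
rewrite outE in run.
have [v_eps|v_eps] := boolP (`|v'| <= eps).
  by exists (x', v'), n; apply: pfar_stop run v_eps.
have M'0 : 0 < M' by rewrite M'E mulr_gt0 ?exprn_gt0.
have D40 : 0 < 4 * D by rewrite mulr_gt0.
have [|out' [n' next]] := IH x' M' (4 * D) M'0 M'L D40 _ hx'.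
  by rewrite mulrA -exprSr.
by exists out', (n + n')%N; apply: pfar_next run v_eps next.
Qed.

End ParameterFree.

(** * The cost of an inner call in closed form *)

Section ParameterFreeLog.
Context {R : realType}.

Lemma log2_le (j : nat) (y : R) : 2 ^+ j <= y -> j%:R <= ln y / ln 2.
Proof.
move=> jy; have y0 : 0 < y by apply: lt_le_trans jy; rewrite exprn_gt0.
have ln2 : 0 < ln 2 :> R by rewrite ln_gt0 // ltr1n.
rewrite ler_pdivlMr // mulr_natl -lnXn // ler_ln ?posrE ?exprn_gt0 //.
Qed.

Definition pfar_const (cA : R) (q : nat) : R :=
  2 * arl_rate cA q * Num.sqrt 28 + stage_overhead q + 6
  + (stage_overhead q + 3) / ln 2.

Lemma pfar_const_ge0 cA q : 0 <= pfar_const cA q.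
Proof.
have ln2 : 0 < ln 2 :> R by rewrite ln_gt0 // ltr1n.
have so0 := @stage_overhead_ge0 R q; have rate0 := @arl_rate_ge0 R cA q.
have il0 : 0 <= (ln 2)^-1 :> R by rewrite invr_ge0 ltW.
have := mulr_ge0 (mulr_ge0 (ler0n R 2) rate0) (sqrtr_ge0 28).
by have := mulr_ge0 so0 il0; rewrite /pfar_const; lra.
Qed.

(** The numbers j of doublings and T of failed guesses are turned into the
    logarithms of the quantities that bound 2^j and 4^T. *)
Lemma pfar_bound (cA : R) q (L M D Dmax eps : R) (j T n : nat) :
  0 < L -> 0 < M -> 0 < D -> D <= Dmax -> 0 < eps ->
  2 ^+ j * M <= 4 * L -> 4 ^+ T * D <= Dmax ->
  n%:R <= arl_rate cA q * (2 * Num.sqrt (28 * L * Dmax / eps)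
             - Num.sqrt (28 * L * D / eps))
             + stage_overhead q * (T%:R + 1) + 3 * j%:R ->
  n%:R <= pfar_const cA q * (1 + Num.sqrt (L * Dmax / eps)
             + ln (1 + Dmax / D) + ln (1 + L / M)).
Proof.
move=> L0 M0 D0 DDmax e0 jM TD n_le.
have ln2 : 0 < ln 2 :> R by rewrite ln_gt0 // ltr1n.
have so0 := @stage_overhead_ge0 R q; have rate0 := @arl_rate_ge0 R cA q.
have LM0 : 0 <= L / M by rewrite divr_ge0 // ltW.
have DD0 : 0 <= Dmax / D by rewrite divr_ge0 ?(ltW D0) // (le_trans (ltW D0)).
have j_le : j%:R <= 2 + ln (1 + L / M) / ln 2.
  have -> : 2 + ln (1 + L / M) / ln 2 = ln (2 ^+ 2 * (1 + L / M)) / ln 2 :> R.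
    rewrite lnM ?posrE ?exprn_gt0 ?ltr_pwDl // lnXn //.
    by rewrite mulr2n; field; rewrite gt_eqF.
  apply: log2_le; rewrite -ler_pdivlMr // in jM; apply: (le_trans jM).
  by rewrite -mulrA; lra.
have T_le : T%:R <= ln (1 + Dmax / D) / ln 2.
  apply: log2_le; apply: (@le_trans _ _ (4 ^+ T)).
    by apply: lerXn2r; rewrite ?nnegrE // ler_nat.
  by rewrite -ler_pdivlMr // in TD; apply: (le_trans TD); lra.
have root28 : Num.sqrt (28 * L * Dmax / eps) = Num.sqrt 28 * Num.sqrt (L * Dmax / eps).
  by rewrite -sqrtrM // !mulrA.
have lnL : 0 <= ln (1 + L / M) by rewrite ln_ge0 // lerDl.
have lnD : 0 <= ln (1 + Dmax / D) by rewrite ln_ge0 // lerDl.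
have s0 : 0 <= Num.sqrt (L * Dmax / eps) := sqrtr_ge0 _.
have s1 : 0 <= Num.sqrt (28 * L * D / eps) := sqrtr_ge0 _.
apply: (le_trans n_le).
set a := 2 * arl_rate cA q * Num.sqrt 28.
have a0 : 0 <= a := mulr_ge0 (mulr_ge0 (ler0n R 2) rate0) (sqrtr_ge0 28).
set il := (ln 2)^-1 in j_le T_le *; have il0 : 0 < il by rewrite invr_gt0.
apply: (@le_trans _ _ (a * Num.sqrt (L * Dmax / eps)
    + stage_overhead q * (ln (1 + Dmax / D) * il + 1) + 3 * (2 + ln (1 + L / M) * il))).
  rewrite root28; have := ler_wpM2l so0 T_le; have := mulr_ge0 rate0 s1.
  by rewrite /a; lra.
rewrite /pfar_const -/a -/il; clear root28 j_le T_le; clearbody a il.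
have i0 := ltW il0.
have H u v : 0 <= u -> 0 <= v -> 0 <= u * v :> R by exact: mulr_ge0.
have := H _ _ a0 lnL; have := H _ _ a0 lnD.
have := H _ _ so0 lnL; have := H _ _ so0 lnD; have := H _ _ so0 s0.
have := H _ _ i0 s0; have := H _ _ (H _ _ i0 so0) s0.
have := H _ _ (H _ _ i0 so0) lnL; have := H _ _ i0 lnD.
have := H _ _ i0 so0.
lra.
Qed.

End ParameterFreeLog.

(** * Multiplier updates *)

Section Diameter.
Context {R : realType} {E : normedModType R}.
Variable h : E -> \bar R.
Hypothesis h_cpt : compact (edom h).

Lemma diameter_ub x y : edom h x -> edom h y -> `|x - y| <= diameter (edom h).
Proof.
move=> hx hy; apply: ub_le_sup; last by exists x => //; exists y.
have [M [_ Mb]] := compact_bounded h_cpt.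
exists (2 * (M + 1)) => _ [u hu [v hv <-]].
have /Mb bnd : M < M + 1 by lra.
have u_le : `|u| <= M + 1 by exact: bnd.
have v_le : `|v| <= M + 1 by exact: bnd.
apply: (le_trans (ler_normB _ _)); lra.
Qed.

End Diameter.

Section OIAL.
Context {R : realType} {E : normedModType R} (ip : {dot E for idfun}).
Hypothesis ip_norm : inner_product_norm ip.
Hypothesis E_fin : @finite_dimensional R E.
Variables (S : inner_solver (R := R) (E := E)) (cA : R) (q : nat).
Hypothesis cA_gt0 : 0 < cA.
Hypothesis S_spec : inner_solver_spec ip S cA q.
Context {m : nat}.
Variables (psis : E -> R) (psin : E -> \bar R).
Variables (A : {linear E -> 'rV[R]_m}) (Astar : 'rV[R]_m -> E) (b : 'rV[R]_m).
Variables (Lbar : R).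
Hypothesis A_adj : adjoint ip A Astar.
Hypothesis psis_smooth : convex_smooth ip psis Lbar.
Hypothesis psin_cpc : closed_proper_convex psin.
Hypothesis psin_cpt : compact (edom psin).
Variables (c eh rh M0 D0 : R).
Hypothesis c_gt0 : 0 < c.
Hypothesis eh_gt0 : 0 < eh.
Hypothesis rh_gt0 : 0 < rh.
Let L := Lbar + c * opnorm A ^+ 2.
Let D := diameter (edom psin).
Let eps := oial_eps psin c eh rh.
Hypothesis L_gt0 : 0 < L.
Hypothesis M0_gt0 : 0 < M0.
Hypothesis M0_le : M0 <= 4 * L.
Hypothesis D0_gt0 : 0 < D0.
Hypothesis D0_le : D0 <= D.

Let D_gt0 : 0 < D.
Proof. exact: lt_le_trans D0_le. Qed.

Lemma oial_eps_gt0 : 0 < eps.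
Proof. by rewrite /eps /oial_eps lt_min rh_gt0 divr_gt0 ?mulr_gt0 ?exprn_gt0. Qed.

(** The tolerance is chosen for this: minimizing the Lagrangian up to eps D costs
    half of what a multiplier update gains while the residual exceeds eh. *)
Lemma oial_epsD : eps * D <= c * eh ^+ 2 / 4.
Proof.
have : eps <= c * eh ^+ 2 / (4 * D) by rewrite /eps /oial_eps ge_min lexx.
move=> /(ler_wpM2r (ltW D_gt0)).
have -> // : c * eh ^+ 2 / (4 * D) * D = c * eh ^+ 2 / 4.
by field; rewrite gt_eqF.
Qed.

Definition pfar_calls_cost : R := pfar_const cA q *
  (1 + Num.sqrt (L * D / eps) + ln (1 + D / D0) + ln (1 + L / M0)).

Lemma oial_inner_step p z z' r' n :
  PF_AR ip S (aug_lagrangian psis A b c p) psin eps z M0 D0 (z', r') n ->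
  edom psin z ->
  [/\ edom psin z', `|r'| <= eps,
    subdiff ip psin z' (r' - grad ip psis z' - Astar (p + c *: (A z' - b))) &
    n%:R <= pfar_calls_cost].
Proof.
move=> run hz.
have smooth := aug_lagrangian_smooth ip_norm A_adj E_fin b p psis_smooth (ltW c_gt0).
have [_ [_ [j [T [[[<- <-] hz'] r_le sub [jM TD] n_le]]]]] :=
  PF_AR_cost ip_norm E_fin cA_gt0 S_spec L_gt0 smooth psin_cpc psin_cpt
    (diameter_ub psin_cpt) oial_eps_gt0 run M0_gt0 M0_le D0_gt0 D0_le hz.
split=> //.
  move: sub.
  rewrite (grad_aug_lagrangian ip_norm A_adj E_fin b p psis_smooth (ltW c_gt0)).
  by rewrite opprD addrA.
apply: pfar_bound n_le => //; exact: oial_eps_gt0.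
Qed.

(** A residual of norm eps changes the Lagrangian by at most eps D over the
    domain, so z' minimizes the Lagrangian at p' up to eps D. *)
Lemma dual_subgradient p' z' r' u :
  edom psin z' -> edom psin u -> `|r'| <= eps ->
  subdiff ip psin z' (r' - grad ip psis z' - Astar p') ->
  psis z' + dotv p' (A z' - b) + fine (psin z') - eps * D <=
  psis u + dotv p' (A u - b) + fine (psin u).
Proof.
move=> hz' hu r_le [_ /(_ u)].
rewrite (edom_fin psin_cpc hz') (edom_fin psin_cpc hu) -EFinD lee_fin.
have [cvx diff _] := psis_smooth.
have := gradient_inequality ip_norm E_fin u cvx (diff z').
have r_ge : - (eps * D) <= ip r' (u - z').
  rewrite lerNl -ipNl; apply: (le_trans (Cauchy_Schwarz ip_norm _ _)).
  by rewrite normrN ler_pM // diameter_ub.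
have -> : ip (r' - grad ip psis z' - Astar p') (u - z') =
   ip r' (u - z') - ip (grad ip psis z') (u - z') - dotv p' (A (u - z')).
  by rewrite 2!ipDl !ipNl (adjointC A_adj) dotvC.
rewrite [A (u - z')]linearB !(dotvDr, dotvNr); lra.
Qed.

(** The residual g is an (eps D)-supergradient of the dual function at the new
    multiplier, so the update is an inexact proximal point step: optimality of
    ps gives <p + c g - ps, g> <= eps D, and the claim is this inequality with
    the square expanded. *)
Lemma multiplier_step p ps z' r' : dual_solutions psis psin A b ps ->
  let g := A z' - b in
  edom psin z' -> `|r'| <= eps ->
  subdiff ip psin z' (r' - grad ip psis z' - Astar (p + c *: g)) ->
  enorm (p + c *: g - ps) ^+ 2 <=
    enorm (p - ps) ^+ 2 + c ^+ 2 * eh ^+ 2 / 2 - c ^+ 2 * enorm g ^+ 2.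
Proof.
move=> ps_opt g hz' r_le sub; set p' := p + c *: g in sub *.
have d_ge : ((psis z' + dotv p' (A z' - b) + fine (psin z') - eps * D)%:E <=
    dual_function psis psin A b p')%E.
  apply: le_ereal_inf_tmp => _ [u _ <-].
  have [hu|] := pselect (edom psin u); last first.
    by rewrite /edom /= ltey => /negP; rewrite negbK => /eqP ->; rewrite addey // leey.
  rewrite (edom_fin psin_cpc hu) -EFinD lee_fin.
  exact: (dual_subgradient hz' hu r_le sub).
have d_le : (dual_function psis psin A b ps <=
    (psis z' + dotv ps (A z' - b) + fine (psin z'))%:E)%E.
  by apply: ereal_inf_lbound; exists z' => //; rewrite (edom_fin psin_cpc hz').
have := le_trans d_ge (le_trans (ps_opt p') d_le); rewrite lee_fin -/g => gap.
have key : dotv (p' - ps) g <= c * eh ^+ 2 / 4.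
  by have := oial_epsD; rewrite dotvDl dotvNl; lra.
clear d_ge d_le gap; clearbody g.
rewrite !sqr_enorm; move: (ler_wpM2l (ltW c_gt0) key).
rewrite /p' !dotvE (dotvC g p) (dotvC g ps) (dotvC p ps).
lra.
Qed.

Lemma multiplier_progress p ps z' r' : dual_solutions psis psin A b ps ->
  edom psin z' -> `|r'| <= eps ->
  subdiff ip psin z' (r' - grad ip psis z' - Astar (p + c *: (A z' - b))) ->
  ~~ (enorm (A z' - b) <= eh) ->
  enorm (p + c *: (A z' - b) - ps) ^+ 2 + c ^+ 2 * eh ^+ 2 / 2 <= enorm (p - ps) ^+ 2.
Proof.
move=> ps_opt hz' r_le sub; rewrite -ltNge => g_gt.
have := multiplier_step ps_opt hz' r_le sub.
have : eh ^+ 2 <= enorm (A z' - b) ^+ 2.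
  by rewrite ler_pXn2r ?nnegrE ?enorm_ge0 ?ltW // ltW.
move=> /(ler_wpM2l (sqr_ge0 c)); lra.
Qed.

(** K counts the multiplier updates that did not stop the loop. It is the same
    for all dual solutions, so that the infimum over them can be taken
    afterwards. *)
Lemma oial_loop_spec z p out n :
  oial_loop ip psis psin A b S c eh rh M0 D0 z p out n -> edom psin z ->
  approx_solution ip psis psin A Astar b eh rh out /\
  exists K : nat, n%:R <= (1 + K%:R) * pfar_calls_cost /\
    forall ps, dual_solutions psis psin A b ps ->
      K%:R * (c ^+ 2 * eh ^+ 2 / 2) <= enorm (p - ps) ^+ 2.
Proof.
elim=> {z p out n} [z p z' r' n run g_le|z p z' r' n out n' run g_gt _ IH] hz.
  have [hz' r_le sub n_le] := oial_inner_step run hz.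
  split.
    by split=> //; apply: (le_trans r_le); rewrite /eps /oial_eps ge_min lexx orbT.
  exists 0%N; rewrite addr0 mul1r; split=> // ps _; rewrite mul0r sqr_ge0 //.
have [hz' r_le sub n_le] := oial_inner_step run hz.
have [sol [K [n'_le K_le]]] := IH hz'; split=> //.
exists K.+1; split=> [|ps ps_opt]; first by rewrite natrD -natr1; lra.
have := multiplier_progress ps_opt hz' r_le sub g_gt; have := K_le ps ps_opt.
rewrite -natr1; lra.
Qed.

Lemma oial_loop_exists z p : edom psin z ->
  dual_solutions psis psin A b !=set0 ->
  exists out n, oial_loop ip psis psin A b S c eh rh M0 D0 z p out n.
Proof.
move=> hz [ps ps_opt].
have step0 : 0 < c ^+ 2 * eh ^+ 2 / 2 by rewrite divr_gt0 ?mulr_gt0 ?exprn_gt0.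
have [k] : exists k : nat, enorm (p - ps) ^+ 2 <= k%:R * (c ^+ 2 * eh ^+ 2 / 2).
  exists (Num.bound (enorm (p - ps) ^+ 2 / (c ^+ 2 * eh ^+ 2 / 2))).
  rewrite -ler_pdivrMr //; apply/ltW/archi_boundP.
  by rewrite divr_ge0 ?sqr_ge0 // ltW.
have smooth p := aug_lagrangian_smooth ip_norm A_adj E_fin b p psis_smooth (ltW c_gt0).
have inner z1 p1 (hz1 : edom psin z1) := PF_AR_exists ip_norm E_fin cA_gt0 S_spec L_gt0
    (smooth p1) psin_cpc psin_cpt (diameter_ub psin_cpt) oial_eps_gt0 M0_gt0
    M0_le D0_gt0 hz1.
elim: k z p hz => [|k IH] z p hz pk; have [[z' r'] [n run]] := inner z p hz;
  have [hz' r_le sub n_le] := oial_inner_step run hz;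
  have [g_le|g_gt] := boolP (enorm (A z' - b) <= eh).
- by exists (z', p + c *: (A z' - b), r'), n; apply: oial_stop run g_le.
- have := multiplier_progress ps_opt hz' r_le sub g_gt.
  have := sqr_ge0 (enorm (p + c *: (A z' - b) - ps)); rewrite mul0r in pk; lra.
- by exists (z', p + c *: (A z' - b), r'), n; apply: oial_stop run g_le.
- have [|out [n' next]] := IH z' (p + c *: (A z' - b)) hz'.
    have := multiplier_progress ps_opt hz' r_le sub g_gt.
    by rewrite -natr1 in pk; lra.
  exists out, (n + n')%N; exact: oial_next run g_gt next.
Qed.

Lemma dual_dist2_ge p (t : R) : 0 <= t -> dual_solutions psis psin A b !=set0 ->
  (forall ps, dual_solutions psis psin A b ps -> t <= enorm (p - ps) ^+ 2) ->
  t <= dual_dist2 psis psin A b p.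
Proof.
move=> t0 [ps ps_opt] t_le.
have : Num.sqrt t <= Defs.edist p (dual_solutions psis psin A b).
  apply: lb_le_inf; first by exists (enorm (p - ps)), ps.
  move=> _ [r r_opt <-]; rewrite -[leRHS]ger0_norm ?enorm_ge0 // -sqrtr_sqr.
  exact: ler_wsqrtr (t_le r r_opt).
move=> root_le; rewrite -[t]sqr_sqrtr // /dual_dist2 lerXn2r ?nnegrE ?sqrtr_ge0 //.
exact: le_trans (sqrtr_ge0 _) root_le.
Qed.

End OIAL.

(** * Elementary estimates for the bound *)

Section Bounds.
Context {R : realType}.
Implicit Types (x y t kappa tau : R).

Lemma ln1D_le_sqrt x : 0 <= x -> ln (1 + x) <= 2 * Num.sqrt x.
Proof.
move=> x0; have s0 := sqrtr_ge0 x.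
have : ln (1 + x) <= ln ((1 + Num.sqrt x) ^+ 2).
  rewrite ler_ln ?posrE; [|lra|by rewrite exprn_gt0 // ltr_pwDl].
  by have := sqr_sqrtr x0; lra.
rewrite lnXn ?ltr_pwDl // => /le_trans; apply.
by rewrite mulr2n mulrDl mul1r lerD // le_ln1Dx // (lt_le_trans _ s0) // ltrN10.
Qed.

(** To be applied with r the square root in the bound, x = L / M0 and y = D / D0.
    Each of 1, x, y is at most 4 x y, hence at most a multiple of r^2, and the
    logarithms are at most twice the square roots. *)
Lemma lower_order_terms kappa r x y : 0 < kappa -> 1 / 4 <= x -> 1 <= y -> 0 <= r ->
  kappa * (x * y) <= 4 * r ^+ 2 ->
  1 + r + ln (1 + y) + ln (1 + x) <= (1 + 5 * Num.sqrt (16 / kappa)) * r.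
Proof.
move=> k0 x4 y1 r0 xy_le; set s := Num.sqrt (16 / kappa).
have s0 : 0 <= s := sqrtr_ge0 _.
have srE : s * r = Num.sqrt (16 / kappa * r ^+ 2).
  by rewrite sqrtrM ?divr_ge0 ?ltW // sqrtr_sqr ger0_norm.
have root_le t : kappa * t <= 16 * r ^+ 2 -> Num.sqrt t <= s * r.
  move=> t_le; rewrite srE; apply: ler_wsqrtr.
  by rewrite mulrAC ler_pdivlMr // mulrC.
have xy_ge : 1 / 4 <= x * y.
  by apply: (le_trans x4); rewrite ler_peMr //; lra.
have one_le : 1 <= s * r.
  by rewrite -[leLHS]sqrtr1; apply: root_le; have := ler_wpM2l (ltW k0) xy_ge; lra.
have y_le : Num.sqrt y <= s * r.
  apply: root_le; have y0 : 0 <= y by lra.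
  by have := ler_wpM2l (ltW k0) (ler_wpM2r y0 x4); lra.
have x_le : Num.sqrt x <= s * r.
  apply: root_le; have x0 : 0 <= x by lra.
  have := ler_wpM2l (ltW k0) (ler_wpM2l x0 y1); have := sqr_ge0 r; lra.
have lx : ln (1 + x) <= 2 * Num.sqrt x by apply: ln1D_le_sqrt; lra.
have ly : ln (1 + y) <= 2 * Num.sqrt y by apply: ln1D_le_sqrt; lra.
by rewrite mulrDl; lra.
Qed.

(** The two branches of the minimum that defines eps correspond to those of the
    maximum under the root; the factor 4 comes from the first. *)
Lemma tolerance_le_root (L D c eh rh : R) :
  0 <= L -> 0 < D -> 0 < c -> 0 < eh -> 0 < rh ->
  L * (D / Num.min (c * eh ^+ 2 / (4 * D)) rh) <=
    4 * Num.sqrt (L * Num.max (D ^+ 2 / (c * eh ^+ 2)) (D / rh)) ^+ 2.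
Proof.
move=> L0 D0 c0 e0 r0.
have D0' := ltW D0.
set mx := Num.max _ _.
have a_le : D ^+ 2 / (c * eh ^+ 2) <= mx by rewrite le_max lexx.
have b_le : D / rh <= mx by rewrite le_max lexx orbT.
have b0 : 0 <= D / rh by rewrite divr_ge0 // ltW.
rewrite sqr_sqrtr; last by rewrite mulr_ge0 // (le_trans b0).
rewrite [leRHS]mulrCA ler_wpM2l //.
rewrite /Num.min; case: ifP => _; last by lra.
have -> : D / (c * eh ^+ 2 / (4 * D)) = 4 * (D ^+ 2 / (c * eh ^+ 2)).
  by field; rewrite !gt_eqF.
by rewrite ler_pM2l.
Qed.

End Bounds.

(** * Complexity of O-IAL *)

(** The estimate M0 is a quarter of a difference quotient of the gradient, so
    the Lipschitz condition bounds it by Lbar / 4; in the affine case the bound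
    is imposed. *)
Lemma initial_estimates_bounds (R : realType) (E : normedModType R)
    (ip : {dot E for idfun}) (psis : E -> R) (psin : E -> \bar R) (Lbar : R)
    (z0 w0 : E) (M0 D0 : R) :
  convex_smooth ip psis Lbar -> compact (edom psin) ->
  initial_estimates ip psis psin Lbar z0 w0 M0 D0 ->
  [/\ edom psin z0, 0 < M0 <= 2 * Lbar & 0 < D0 <= diameter (edom psin)].
Proof.
move=> [_ _ lip] cpt [hz0 hw0 w0z0 -> M0P].
have dist0 : 0 < `|z0 - w0| by rewrite normr_gt0 subr_eq0 eq_sym.
split=> //; last by rewrite dist0 diameter_ub.
case: M0P => [[dg0 ->]|[_ //]].
have dg : 0 < `|grad ip psis z0 - grad ip psis w0|.
  by rewrite normr_gt0 subr_eq0 eq_sym.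
rewrite divr_gt0 ?mulr_gt0 //= ler_pdivrMr ?mulr_gt0 //.
by have := lip z0 w0; lra.
Qed.

Definition oial_const (R : realType) (cA : R) (q : nat) : R :=
  2 + 4 * pfar_const cA q.

Lemma oial_const_ge0 (R : realType) (cA : R) q : 0 <= oial_const cA q.
Proof. by have := @pfar_const_ge0 R cA q; rewrite /oial_const; lra. Qed.

Section Complexity.
Context {R : realType} {E : normedModType R} (ip : {dot E for idfun}).
Hypothesis ip_norm : inner_product_norm ip.
Hypothesis E_fin : @finite_dimensional R E.
Variables (S : inner_solver (R := R) (E := E)) (cA : R) (q : nat).
Hypothesis cA_gt0 : 0 < cA.
Hypothesis S_spec : inner_solver_spec ip S cA q.
Context {m : nat}.
Variables (psis : E -> R) (psin : E -> \bar R).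
Variables (A : {linear E -> 'rV[R]_m}) (Astar : 'rV[R]_m -> E) (b : 'rV[R]_m).
Variables (Lbar : R) (z0 w0 : E) (p0 : 'rV[R]_m) (M0 D0 : R).
Hypothesis A_adj : adjoint ip A Astar.
Hypothesis psis_smooth : convex_smooth ip psis Lbar.
Hypothesis psin_cpc : closed_proper_convex psin.
Hypothesis psin_cpt : compact (edom psin).
Hypothesis init : initial_estimates ip psis psin Lbar z0 w0 M0 D0.
Hypothesis dual_ex : dual_solutions psis psin A b !=set0.

Let D := diameter (edom psin).
Let nA := opnorm A.
Let Pi0 := dual_dist2 psis psin A b p0.
Let run c eh rh := O_IAL ip psis psin A b S c eh rh M0 D0 z0 p0.
Let root c eh rh := Num.sqrt ((Lbar + c * nA ^+ 2) *
                      Num.max (D ^+ 2 / (c * eh ^+ 2)) (D / rh)).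
Let terms c eh rh := 1 + root c eh rh + ln (1 + D / D0)
                       + ln (1 + (Lbar + c * nA ^+ 2) / M0).

Let M0_gt0 : 0 < M0.
Proof. by have [_ /andP[]] := initial_estimates_bounds psis_smooth psin_cpt init. Qed.

Let M0_le : M0 <= 2 * Lbar.
Proof. by have [_ /andP[]] := initial_estimates_bounds psis_smooth psin_cpt init. Qed.

Let D0_gt0 : 0 < D0.
Proof. by have [_ _ /andP[]] := initial_estimates_bounds psis_smooth psin_cpt init. Qed.

Let D0_le : D0 <= D.
Proof. by have [_ _ /andP[]] := initial_estimates_bounds psis_smooth psin_cpt init. Qed.

Let Lbar_gt0 : 0 < Lbar.
Proof. have := M0_gt0; have := M0_le; lra. Qed.

Let D_gt0 : 0 < D.
Proof. exact: lt_le_trans D0_le. Qed.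

Let Pi0_ge0 : 0 <= Pi0.
Proof. exact: sqr_ge0. Qed.

Lemma aug_modulus_ge c : 0 < c -> Lbar <= Lbar + c * nA ^+ 2.
Proof. by move=> c0; rewrite lerDl mulr_ge0 ?sqr_ge0 // ltW. Qed.

Lemma aug_modulus_ge0 c : 0 < c -> 0 <= Lbar + c * nA ^+ 2.
Proof. by move=> /aug_modulus_ge; apply: le_trans; exact: ltW. Qed.

Section FixedParameters.
Variables (c eh rh : R).
Hypotheses (c_gt0 : 0 < c) (eh_gt0 : 0 < eh) (rh_gt0 : 0 < rh).
Let L := Lbar + c * nA ^+ 2.

Let L_gt0 : 0 < L.
Proof. exact: lt_le_trans (aug_modulus_ge c_gt0). Qed.

Let M0_le4 : M0 <= 4 * L.
Proof.
have := aug_modulus_ge c_gt0; have := M0_le; have := Lbar_gt0; rewrite /L; lra.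
Qed.

Let z0_dom : edom psin z0.
Proof. by case: init. Qed.

Lemma O_IAL_exists : exists out N, run c eh rh out N.
Proof.
have [out [n loop]] := oial_loop_exists ip_norm E_fin cA_gt0 S_spec A_adj
  psis_smooth psin_cpc psin_cpt c_gt0 eh_gt0 rh_gt0 L_gt0 M0_gt0 M0_le4 D0_gt0
  D0_le p0 z0_dom dual_ex.
by exists out, n.+2, n.
Qed.

Lemma terms_ge1 : 1 <= terms c eh rh.
Proof.
have lnL : 0 <= ln (1 + L / M0) by rewrite ln_ge0 // lerDl divr_ge0 // ltW.
have lnD : 0 <= ln (1 + D / D0) by rewrite ln_ge0 // lerDl divr_ge0 // ltW.
by have := sqrtr_ge0 (L * Num.max (D ^+ 2 / (c * eh ^+ 2)) (D / rh));
  rewrite /terms -/L /root -/L; lra.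
Qed.

Lemma O_IAL_complexity out N : run c eh rh out N ->
  approx_solution ip psis psin A Astar b eh rh out /\
  N%:R <= oial_const cA q * (1 + Pi0 / (eh ^+ 2 * c ^+ 2)) * terms c eh rh.
Proof.
move=> [n loop ->].
have [sol [K [n_le K_le]]] := oial_loop_spec ip_norm E_fin cA_gt0 S_spec A_adj
  psis_smooth psin_cpc psin_cpt c_gt0 eh_gt0 rh_gt0 L_gt0 M0_gt0 M0_le4 D0_gt0
  D0_le loop z0_dom.
split=> //.
have ce0 : 0 < c ^+ 2 * eh ^+ 2 by rewrite mulr_gt0 ?exprn_gt0.
have KPi : K%:R * (c ^+ 2 * eh ^+ 2 / 2) <= Pi0.
  by apply: dual_dist2_ge => //; rewrite mulr_ge0 // ltW // divr_gt0.
have {}KPi : K%:R <= 2 * (Pi0 / (eh ^+ 2 * c ^+ 2)).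
  rewrite mulrA (mulrC (eh ^+ 2)) ler_pdivlMr //; lra.
have := tolerance_le_root (ltW L_gt0) D_gt0 c_gt0 eh_gt0 rh_gt0.
rewrite -/(root c eh rh) -/(oial_eps psin c eh rh) mulrA => eps_root.
have cost_le : pfar_calls_cost cA q psin A Lbar c eh rh M0 D0 <=
    2 * pfar_const cA q * terms c eh rh.
  have C0 := @pfar_const_ge0 R cA q.
  have sqrt_le : Num.sqrt (L * D / oial_eps psin c eh rh) <= 2 * root c eh rh.
    have r0 : 0 <= root c eh rh := sqrtr_ge0 _.
    rewrite -[leRHS]ger0_norm ?mulr_ge0 // -sqrtr_sqr; apply: ler_wsqrtr.
    by rewrite exprMn; move: eps_root; lra.
  rewrite /pfar_calls_cost [X in X * terms _ _ _]mulrC -[leRHS]mulrA.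
  apply: ler_wpM2l => //; rewrite /terms -/D -/nA -/L.
  have lnL : 0 <= ln (1 + L / M0) by rewrite ln_ge0 // lerDl divr_ge0 // ltW.
  have lnD : 0 <= ln (1 + D / D0) by rewrite ln_ge0 // lerDl divr_ge0 // ltW.
  lra.
rewrite -addn2 natrD; have T1 := terms_ge1.
have P0 : 0 <= Pi0 / (eh ^+ 2 * c ^+ 2) by rewrite divr_ge0 // mulr_ge0 ?sqr_ge0.
have C0 := @pfar_const_ge0 R cA q.
have CT0 : 0 <= 2 * pfar_const cA q * terms c eh rh.
  by rewrite mulr_ge0 ?mulr_ge0 // (le_trans ler01).
have K1 : 0 <= 1 + K%:R :> R by rewrite addr_ge0.
have := ler_wpM2l K1 cost_le.
have := ler_wpM2r CT0 KPi.
have : 1 <= (1 + Pi0 / (eh ^+ 2 * c ^+ 2)) * terms c eh rh.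
  by rewrite mulr_ege1 // lerDl.
rewrite /oial_const; move: n_le; lra.
Qed.

Lemma terms_le_root kappa : 0 < kappa -> kappa * oial_eps psin c eh rh <= M0 * D0 ->
  terms c eh rh <= (1 + 5 * Num.sqrt (16 / kappa)) * root c eh rh.
Proof.
move=> k0 keps; have e0 := oial_eps_gt0 c_gt0 eh_gt0 rh_gt0 D0_gt0 D0_le.
apply: lower_order_terms => //.
- by rewrite ler_pdivlMr // -/L; have := M0_le4; lra.
- by rewrite ler_pdivlMr // mul1r.
- exact: sqrtr_ge0.
have := tolerance_le_root (ltW L_gt0) D_gt0 c_gt0 eh_gt0 rh_gt0.
rewrite -/(root c eh rh) -/(oial_eps psin c eh rh); apply: le_trans.
have -> : kappa * ((Lbar + c * nA ^+ 2) / M0 * (D / D0)) = L * D * (kappa / (M0 * D0)).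
  by rewrite /L; field; rewrite !gt_eqF.
rewrite [leRHS]mulrA; apply: ler_wpM2l; first by rewrite mulr_ge0 ?ltW.
by rewrite ler_pdivrMr ?mulr_gt0 // mulrC ler_pdivlMr.
Qed.

End FixedParameters.

(** The lower bound kappa on the predicted number of updates absorbs the one call
    that always takes place, and the lower bound on M0 D0 the logarithms. *)
Lemma O_IAL_complexity_dominant kappa c eh rh out N :
  0 < kappa -> 0 < c -> 0 < eh -> 0 < rh ->
  kappa <= Pi0 / (eh ^+ 2 * c ^+ 2) ->
  kappa * oial_eps psin c eh rh <= M0 * D0 ->
  run c eh rh out N ->
  N%:R <= oial_const cA q * (kappa^-1 + 1) * (1 + 5 * Num.sqrt (16 / kappa)) *
    (Pi0 / (eh ^+ 2 * c ^+ 2) * root c eh rh).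
Proof.
move=> k0 c0 e0 r0 kP keps runN.
have [_ N_le] := O_IAL_complexity c0 e0 r0 runN; apply: (le_trans N_le).
have C0 := @oial_const_ge0 R cA q.
set P := Pi0 / _ in kP *; set T := terms _ _ _.
have P_le : 1 + P <= (kappa^-1 + 1) * P.
  have : 1 <= kappa^-1 * P by rewrite ler_pdivlMl // mulr1.
  lra.
have T_le : T <= (1 + 5 * Num.sqrt (16 / kappa)) * root c eh rh.
  exact: terms_le_root.
have T0 : 0 <= T by apply: (le_trans ler01); apply: terms_ge1.
rewrite -[leLHS]mulrA -!(mulrA (oial_const _ _)) ler_wpM2l // mulrACA.
by apply: ler_pM => //; lra.
Qed.

(** With c between tau1 / eh and tau2 / eh, every occurrence of c is replaced by
    1 / eh at the price of factors 1 / tau1^2, max 1 tau2 and max 1 (1 / tau1). *)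
Lemma O_IAL_complexity_penalty kappa tau1 tau2 c eh rh out N :
  0 < kappa -> 0 < tau1 -> 0 < c -> 0 < eh -> 0 < rh ->
  tau1 / eh <= c <= tau2 / eh -> kappa <= Pi0 ->
  kappa * oial_eps psin c eh rh <= M0 * D0 ->
  run c eh rh out N ->
  N%:R <= oial_const cA q * (kappa^-1 + tau1 ^- 2) *
      ((1 + 5 * Num.sqrt (16 / kappa)) *
       Num.sqrt (Num.max 1 tau2 * Num.max 1 tau1^-1)) *
    (Pi0 * Num.sqrt ((Lbar + nA ^+ 2 / eh) * Num.max (D ^+ 2 / eh) (D / rh))).
Proof.
move=> k0 t0 c0 e0 r0 /andP[t1c ct2] kP keps runN.
have [_ N_le] := O_IAL_complexity c0 e0 r0 runN; apply: (le_trans N_le).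
have C0 := @oial_const_ge0 R cA q; have L0 := Lbar_gt0.
have tau1_le : tau1 <= eh * c by rewrite mulrC -ler_pdivrMr.
have c_le : c * eh <= tau2 by rewrite -ler_pdivlMr.
set P := Pi0 / _; set T := terms _ _ _.
have P_le : 1 + P <= (kappa^-1 + tau1 ^- 2) * Pi0.
  have : 1 <= kappa^-1 * Pi0 by rewrite ler_pdivlMl // mulr1.
  have : P <= tau1 ^- 2 * Pi0.
    rewrite /P mulrC ler_wpM2r // lef_pV2 ?posrE ?mulr_gt0 ?exprn_gt0 //.
    by rewrite -exprMn lerXn2r ?nnegrE // ?mulr_ge0 // ltW.
  lra.
have T_le : T <= (1 + 5 * Num.sqrt (16 / kappa)) * root c eh rh.
  exact: terms_le_root.
set X := Num.max 1 tau2 * Num.max 1 tau1^-1.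
set Y := (Lbar + nA ^+ 2 / eh) * Num.max (D ^+ 2 / eh) (D / rh).
have max1 : 1 <= Num.max 1 tau2 by rewrite le_max lexx.
have max2 : 1 <= Num.max 1 tau1^-1 by rewrite le_max lexx.
have nA_eh : 0 <= nA ^+ 2 / eh by rewrite divr_ge0 ?sqr_ge0 // ltW.
have modulus_le : Lbar + c * nA ^+ 2 <= Num.max 1 tau2 * (Lbar + nA ^+ 2 / eh).
  have : Lbar <= Num.max 1 tau2 * Lbar by rewrite ler_peMl // ltW.
  have : c * nA ^+ 2 <= Num.max 1 tau2 * (nA ^+ 2 / eh).
    have -> : c * nA ^+ 2 = c * eh * (nA ^+ 2 / eh) by field; rewrite gt_eqF.
    by rewrite ler_wpM2r // le_max c_le orbT.
  lra.
have radius_le : Num.max (D ^+ 2 / (c * eh ^+ 2)) (D / rh) <=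
    Num.max 1 tau1^-1 * Num.max (D ^+ 2 / eh) (D / rh).
  have D2 : 0 <= D ^+ 2 / eh by rewrite divr_ge0 ?sqr_ge0 // ltW.
  have Dr : 0 <= D / rh by rewrite divr_ge0 // ltW.
  rewrite ge_max; apply/andP; split.
    have -> : D ^+ 2 / (c * eh ^+ 2) = (eh * c)^-1 * (D ^+ 2 / eh).
      by field; rewrite !gt_eqF.
    apply: ler_pM => //; first by rewrite invr_ge0 mulr_ge0 // ltW.
      by rewrite le_max lef_pV2 ?posrE ?mulr_gt0 // tau1_le orbT.
    by rewrite le_max lexx.
  rewrite -[leLHS]mul1r; apply: ler_pM => //; by rewrite le_max lexx orbT.
have root_le : root c eh rh <= Num.sqrt X * Num.sqrt Y.
  rewrite -sqrtrM; last by rewrite mulr_ge0 // (le_trans ler01).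
  apply: ler_wsqrtr; rewrite /X /Y mulrACA; apply: ler_pM => //.
    exact: aug_modulus_ge0.
  by rewrite le_max; apply/orP; right; rewrite divr_ge0 // ltW.
have T0 : 0 <= T by apply: (le_trans ler01); apply: terms_ge1.
have s0 : 0 <= 1 + 5 * Num.sqrt (16 / kappa) by have := sqrtr_ge0 (16 / kappa); lra.
have {}T_le : T <= (1 + 5 * Num.sqrt (16 / kappa)) * Num.sqrt X * Num.sqrt Y.
  by apply: (le_trans T_le); rewrite -mulrA ler_wpM2l.
rewrite -[leLHS]mulrA -!(mulrA (oial_const _ _)) ler_wpM2l // mulrACA.
apply: ler_pM => //; by rewrite addr_ge0 // divr_ge0 // mulr_ge0 // sqr_ge0.
Qed.

(** Since eh <= emax, the modulus Lbar + c |A|^2 and the radius term are both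
    O (1 / eh), so their geometric mean is, and the constants and the logarithms
    are too. *)
Lemma O_IAL_complexity_inverse tau1 tau2 emax : 0 < tau1 -> 0 < emax ->
  exists K, forall c eh out N, 0 < c -> 0 < eh <= emax ->
    tau1 / eh <= c <= tau2 / eh -> run c eh eh out N -> N%:R <= K / eh.
Proof.
move=> t0 em0; pose Lmax := Lbar * emax + tau2 * nA ^+ 2.
pose Dmax := Num.max (D ^+ 2 / tau1) D.
exists (oial_const cA q * (1 + Pi0 / tau1 ^+ 2) *
  (emax + Num.sqrt (Lmax * Dmax) + emax * ln (1 + D / D0) + Lmax / M0)).
move=> c eh out N c0 /andP[e0 e_le] /andP[t1c ct2] runN.
have [_ N_le] := O_IAL_complexity c0 e0 e0 runN; apply: (le_trans N_le).
have C0 := @oial_const_ge0 R cA q; have L0 := Lbar_gt0.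
have tau1_le : tau1 <= eh * c by rewrite mulrC -ler_pdivrMr.
have P_le : Pi0 / (eh ^+ 2 * c ^+ 2) <= Pi0 / tau1 ^+ 2.
  rewrite ler_wpM2l // lef_pV2 ?posrE ?mulr_gt0 ?exprn_gt0 //.
  by rewrite -exprMn lerXn2r ?nnegrE // ?mulr_ge0 // ltW.
have one_le : 1 <= emax / eh by rewrite ler_pdivlMr // mul1r.
have modulus_le : Lbar + c * nA ^+ 2 <= Lmax / eh.
  have : Lbar <= Lbar * (emax / eh) by rewrite ler_peMr // ltW.
  have : c * nA ^+ 2 <= tau2 / eh * nA ^+ 2 by rewrite ler_wpM2r ?sqr_ge0.
  by rewrite /Lmax; lra.
have modulus_ge0 := aug_modulus_ge0 c0.
have Deh : 0 <= D / eh by rewrite divr_ge0 // ltW.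
have radius_le : Num.max (D ^+ 2 / (c * eh ^+ 2)) (D / eh) <= Dmax / eh.
  rewrite ge_max; apply/andP; split.
    have -> : D ^+ 2 / (c * eh ^+ 2) = D ^+ 2 / (eh * c) / eh.
      by field; rewrite !gt_eqF.
    rewrite ler_pM2r ?invr_gt0 // le_max; apply/orP; left.
    by rewrite ler_wpM2l ?sqr_ge0 // lef_pV2 ?posrE ?mulr_gt0.
  by rewrite ler_pM2r ?invr_gt0 // le_max lexx orbT.
have root_le : root c eh eh <= Num.sqrt (Lmax * Dmax) / eh.
  rewrite -[X in _ / X]ger0_norm ?(ltW e0) // -sqrtr_sqr -sqrtrV ?sqr_ge0 //.
  rewrite -sqrtrM.
    apply: ler_wsqrtr; have -> : Lmax * Dmax * eh ^- 2 = Lmax / eh * (Dmax / eh).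
      by field; rewrite gt_eqF.
    by apply: ler_pM => //; rewrite le_max Deh orbT.
  rewrite mulr_ge0 //.
    by rewrite -(pmulr_lge0 _ (_ : 0 < eh^-1)) ?invr_gt0 // (le_trans modulus_ge0).
  by rewrite le_max (ltW D_gt0) orbT.
have lnD : 0 <= ln (1 + D / D0) by rewrite ln_ge0 // lerDl divr_ge0 // ltW.
have lnD_le : ln (1 + D / D0) <= emax / eh * ln (1 + D / D0) by rewrite ler_peMl.
have lnL_le : ln (1 + (Lbar + c * nA ^+ 2) / M0) <= Lmax / eh / M0.
  apply: (@le_trans _ _ ((Lbar + c * nA ^+ 2) / M0)).
    apply: le_ln1Dx; rewrite (lt_le_trans (ltrN10 R)) // divr_ge0 //; exact: ltW.
  by rewrite ler_pM2r ?invr_gt0.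
rewrite -[leRHS]mulrA; apply: ler_pM.
- by rewrite mulr_ge0 // addr_ge0 // divr_ge0 // mulr_ge0 // sqr_ge0.
- by apply: (le_trans ler01); apply: terms_ge1.
- by rewrite ler_wpM2l // lerD2l.
rewrite /terms; move: lnL_le lnD_le root_le; lra.
Qed.

End Complexity.

Theorem theorem2p8 (R : realType) (cA : R) (q : nat) (cA_gt0 : 0 < cA) :
  exists (C0 : R) (C1 : R -> R) (C2 : R -> R -> R -> R),
  forall (E : normedModType R) (ip : {dot E for idfun}) (m : nat)
    (psis : E -> R) (psin : E -> \bar R)
    (A : {linear E -> 'rV[R]_m}) (Astar : 'rV[R]_m -> E) (b : 'rV[R]_m)
    (Lbar : R) (S : inner_solver (R := R) (E := E))
    (z0 w0 : E) (p0 : 'rV[R]_m) (M0 D0 : R),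
  @finite_dimensional R E -> inner_product_norm ip ->
  adjoint ip A Astar -> (exists z, A z != 0) ->
  convex_smooth ip psis Lbar ->
  closed_proper_convex psin -> compact (edom psin) ->
  inner_solver_spec ip S cA q ->
  initial_estimates ip psis psin Lbar z0 w0 M0 D0 ->
  (exists zs ps, optimal_pair ip psis psin A Astar b zs ps) ->
  let D := diameter (edom psin) in
  let nA := opnorm A in
  let Pi0 := dual_dist2 psis psin A b p0 in
  let eps c eh rh := oial_eps psin c eh rh in
  let run c eh rh := O_IAL ip psis psin A b S c eh rh M0 D0 z0 p0 in
  let root c eh rh := Num.sqrt ((Lbar + c * nA ^+ 2) *
                        Num.max (D ^+ 2 / (c * eh ^+ 2)) (D / rh)) in
  [/\
    (forall c eh rh, 0 < c -> 0 < eh -> 0 < rh ->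
       (exists out N, run c eh rh out N) /\
       (forall out N, run c eh rh out N ->
          approx_solution ip psis psin A Astar b eh rh out)),
    (forall c eh rh, 0 < c -> 0 < eh -> 0 < rh ->
       forall out N, run c eh rh out N ->
         N%:R <= C0 * (1 + Pi0 / (eh ^+ 2 * c ^+ 2)) *
                 (1 + root c eh rh + ln (1 + D / D0)
                    + ln (1 + (Lbar + c * nA ^+ 2) / M0))),
    (forall kappa c eh rh, 0 < kappa -> 0 < c -> 0 < eh -> 0 < rh ->
       kappa <= Pi0 / (eh ^+ 2 * c ^+ 2) ->
       kappa * eps c eh rh <= M0 * D0 ->
       forall out N, run c eh rh out N ->
         N%:R <= C1 kappa * (Pi0 / (eh ^+ 2 * c ^+ 2) * root c eh rh)),
    (forall kappa tau1 tau2 c eh rh,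
       0 < kappa -> 0 < tau1 -> 0 < c -> 0 < eh -> 0 < rh ->
       tau1 / eh <= c <= tau2 / eh ->
       kappa <= Pi0 ->
       kappa * eps c eh rh <= M0 * D0 ->
       forall out N, run c eh rh out N ->
         N%:R <= C2 kappa tau1 tau2 *
           (Pi0 * Num.sqrt ((Lbar + nA ^+ 2 / eh) *
                            Num.max (D ^+ 2 / eh) (D / rh)))) &
    (forall tau1 tau2 emax, 0 < tau1 -> 0 < emax ->
       exists K, forall c eh, 0 < c -> 0 < eh <= emax ->
         tau1 / eh <= c <= tau2 / eh ->
         (exists out N, run c eh eh out N) /\
         (forall out N, run c eh eh out N ->
            approx_solution ip psis psin A Astar b eh eh out /\
            N%:R <= K / eh))].
Proof.
exists (oial_const cA q),
  (fun kappa => oial_const cA q * (kappa^-1 + 1) * (1 + 5 * Num.sqrt (16 / kappa))),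
  (fun kappa tau1 tau2 => oial_const cA q * (kappa^-1 + tau1 ^- 2) *
     ((1 + 5 * Num.sqrt (16 / kappa)) *
      Num.sqrt (Num.max 1 tau2 * Num.max 1 tau1^-1))).
move=> E ip m psis psin A Astar b Lbar S z0 w0 p0 M0 D0 E_fin ip_norm A_adj _.
move=> psis_smooth psin_cpc psin_cpt S_spec init [_ [ps [_ _ ps_opt]]].
have dual_ex : dual_solutions psis psin A b !=set0 by exists ps.
have ex := O_IAL_exists ip_norm E_fin cA_gt0 S_spec p0 A_adj psis_smooth
  psin_cpc psin_cpt init dual_ex.
have bound := O_IAL_complexity ip_norm E_fin cA_gt0 S_spec A_adj psis_smooth
  psin_cpc psin_cpt init dual_ex.
move=> D nA Pi0 eps run root; split.
- move=> c eh rh c0 e0 r0; split; first exact: ex.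
  by move=> out N /(bound _ _ _ _ c0 e0 r0)[].
- by move=> c eh rh c0 e0 r0 out N /(bound _ _ _ _ c0 e0 r0)[].
- move=> kappa c eh rh k0 c0 e0 r0 kP keps out N.
  exact: (O_IAL_complexity_dominant ip_norm E_fin cA_gt0 S_spec A_adj psis_smooth
    psin_cpc psin_cpt init dual_ex).
- move=> kappa tau1 tau2 c eh rh k0 t0 c0 e0 r0 ct kP keps out N.
  exact: (O_IAL_complexity_penalty ip_norm E_fin cA_gt0 S_spec A_adj psis_smooth
    psin_cpc psin_cpt init dual_ex).
move=> tau1 tau2 emax t0 em0.
have [K K_le] := O_IAL_complexity_inverse ip_norm E_fin cA_gt0 S_spec p0 A_adj
  psis_smooth psin_cpc psin_cpt init dual_ex tau2 t0 em0.
exists K => c eh c0 e_em ct; have /andP[e0 _] := e_em; split; first exact: ex.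
move=> out N runN; split; first by have [] := bound _ _ _ _ c0 e0 e0 _ _ runN.
exact: K_le runN.
Qed.
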